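(* Let $\mathcal F$ be any class of joint distributions of $(Y,X)$ on $[0,1]^2$ such that any distribution in $\mathcal F$ satisfies the regularity conditions (i)–(vi) listed in the context, with constants $C_0,\overline C,\overline C',\underline C\in(0,\infty)$ and $C^*\in(0,2)$. Let $\mathit{data}$ be $n$ i.i.d. draws from $F_{Y,X}$, and define the minimax difference in the revenues at a given covariate value $x_0$ $$\mathscr R_n^D(x_0;\mathcal F)=\inf_{\check p_D}\ \sup_{F_{Y,X}\in\mathcal F}\Big(r(p_D^*(x_0;F_{Y,X}),x_0,F_{Y,X})-\mathbb E_{F_{Y,X}}\big[r(\check p_D(x_0;\mathit{data}),x_0,F_{Y,X})\big]\Big),$$ where the infimum is over all data-based pricing strategies $\check p_D$ (all rules that map the sample $\mathit{data}$ to a measurable pricing function $\check p_D(\cdot\,;\mathit{data}):[0,1]\to[0,1]$). Then, for $x_0\in(0,1)$, $$\mathscr R_n^D(x_0;\mathcal F)\ge c\,n^{-1/2}$$ for a positive universal constant $c$ (independent of $n$), if $x_0n^{1/4}\ge c'$ and $(1-x_0)n^{1/4}\ge c''$ for some positive universal constants $c'$ and $c''$ (independent of $n$ and $x_0$).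
   Context: Setting. $Y\in[0,1]$ is a buyer's valuation and $X\in[0,1]$ a covariate, with joint distribution $F_{Y,X}$, marginal density $f_X$ of $X$, conditional density $f_{Y|X}(y|x)$ and conditional CDF $F_{Y|X}(y|x)$. For $y,x\in[0,1]$, $r(y,x,F_{Y,X})=r(y,x)=y(1-F_{Y|X}(y|x))$, and $p_D^*(x)=p_D^*(x;F_{Y,X})$ is the maximizer of $r(\cdot,x)$ over $[0,1]$. $\mathbb E_{F_{Y,X}}$ is the expectation over $\mathit{data}\sim F_{Y,X}$. Regularity conditions on $F_{Y,X}$: (i) $|f_{Y|X}(y|x)-f_{Y|X}(y'|x)|\le C_0|y-y'|$ for all $y,y',x\in[0,1]$. (ii) The revenue function $r(y,x)$ is strictly concave (in $y$) with second-order derivative $-2f_{Y|X}(y|x)-y\,\partial_y f_{Y|X}(y|x)\le -C^*$ a.e. (iii) $p_D^*(x)\in(0,1)$ for each $x\in[0,1]$. (iv) $f_{Y|X}(y|x)$ is continuously differentiable in $(x,y)$ in a neighborhood of the curve $\{(x,p_D^*(x)):x\in[0,1]\}$. (v) $|2f_{Y|X}(y|x)+y\,\partial_y f_{Y|X}(y|x)|\le\overline C$ and $|\partial_x F_{Y|X}(y|x)+y\,\partial_x f_{Y|X}(y|x)|\le\overline C$ a.e. (vi) $\underline C\le f_X\le\overline C'$ on $[0,1]$.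
   Formalization: The class F is taken to be all distributions satisfying (i)–(vi), since for a single-law class the bound fails; the constants are restricted to C̄ > 2 and C̲ ≤ 1 ≤ C̄′, since otherwise the class is empty or forces a uniform conditional law and the bound is false. *)

(* Defs.v *)
From HB Require Import structures.
From mathcomp Require Import all_boot all_order all_algebra.
From mathcomp Require Import all_classical all_reals all_analysis.

Set Implicit Arguments.
Unset Strict Implicit.
Unset Printing Implicit Defensive.

Import Order.TTheory GRing.Theory Num.Theory.
Import numFieldNormedType.Exports.

Local Open Scope classical_set_scope.
Local Open Scope ring_scope.

Notation lebesgue2 R := (@lebesgue_measure R \x @lebesgue_measure R)%E.

(** In this file a function [g : R -> R -> R] of a valuation and a covariate
    takes the valuation [y] first: [g y x].  Likewise an observation is a pair
    [(y, x)]. *)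
Definition partial_y (R : realType) (g : R -> R -> R) (y x : R) : R :=
  derive1 (fun s : R => g s x) y.

Definition partial_x (R : realType) (g : R -> R -> R) (y x : R) : R :=
  derive1 (fun s : R => g y s) x.

Definition C1_on (R : realType) (U : set (R * R)) (g : R -> R -> R) : Prop :=
  forall z : R * R, U z ->
    [/\ derivable (fun s : R => g s z.2) z.1 1,
        derivable (fun s : R => g z.1 s) z.2 1,
        {for z, continuous (fun w : R * R => partial_y g w.1 w.2)} &
        {for z, continuous (fun w : R * R => partial_x g w.1 w.2)}].

(** A joint law of (Y, X) on [0,1]^2 together with a marginal density of X and
    a version of the conditional density of Y given X.  The values of the
    densities outside the unit interval (square) are irrelevant. *)
Record joint_dist (R : realType) := JointDist {
  law : probability (R * R)%type R ;
  fX : R -> R ;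
  fYX : R -> R -> R ;
  measurable_fX : measurable_fun setT fX ;
  measurable_fYX : measurable_fun setT (fun z : R * R => fYX z.1 z.2) ;
  fX_ge0 : forall x : R, x \in `[0, 1] -> 0 <= fX x ;
  fYX_ge0 : forall y x : R, y \in `[0, 1] -> x \in `[0, 1] -> 0 <= fYX y x ;
  fYX_int1 : forall x : R, x \in `[0, 1] ->
    (\int[lebesgue_measure]_(y in `[0%R, 1%R]) (fYX y x)%:E = 1)%E ;
  lawE : forall A : set (R * R), measurable A ->
    law A = (\int[lebesgue2 R]_(z in A `&` (`[0%R, 1%R] `*` `[0%R, 1%R]))
               (fYX z.1 z.2 * fX z.2)%:E)%E }.

Section pricing.
Context {R : realType}.
Implicit Types (D : joint_dist R) (y x p : R).

Definition condCDF D y x : R :=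
  \int[lebesgue_measure]_(u in `[0, y]) fYX D u x.

Definition revenue D y x : R := y * (1 - condCDF D y x).

(** The regularity conditions below make the maximizer exist and be unique. *)
Definition pD D x : R :=
  get [set p : R | p \in `[0, 1] /\
    forall q : R, q \in `[0, 1] -> revenue D q x <= revenue D p x].

Definition density_lipschitz_y (C0 : R) D : Prop :=
  forall y y' x : R, y \in `[0, 1] -> y' \in `[0, 1] -> x \in `[0, 1] ->
    `|fYX D y x - fYX D y' x| <= C0 * `|y - y'|.

Definition revenue_concave (Cs : R) D : Prop :=
  (forall x y y' t : R, x \in `[0, 1] -> y \in `[0, 1] -> y' \in `[0, 1] ->
     y != y' -> t \in `]0, 1[ ->
     t * revenue D y x + (1 - t) * revenue D y' x
       < revenue D (t * y + (1 - t) * y') x) /\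
  {ae lebesgue2 R, forall z : R * R,
     z.1 \in `]0, 1[ -> z.2 \in `]0, 1[ ->
     derivable (fun s : R => fYX D s z.2) z.1 1 /\
     - (2 * fYX D z.1 z.2) - z.1 * partial_y (fYX D) z.1 z.2 <= - Cs}.

Definition interior_price D : Prop :=
  forall x : R, x \in `[0, 1] -> pD D x \in `]0, 1[.

(** Continuous differentiability near a curve that reaches the sides x = 0 and
    x = 1 of the square is that of an extension [g] to an open set of R^2. *)
Definition density_C1_near_price D : Prop :=
  exists (U : set (R * R)) (g : R -> R -> R),
    [/\ open U,
        (forall x : R, x \in `[0, 1] -> U (pD D x, x)),
        (forall y x : R, y \in `[0, 1] -> x \in `[0, 1] -> U (y, x) ->
           fYX D y x = g y x) &
        C1_on U g].

(** A bound on almost-everywhere derivatives in x says nothing about the values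
    at a given x0 (the version of the conditional density could be altered
    there) unless the functions differentiated are recovered from their
    derivatives.  The Lipschitz clause states this; its constant depends on y
    and on D.  Nothing is lost: for functions absolutely continuous in x the
    last bound yields Lipschitz constants C for F(y|.) and 2C/y for f(y|.). *)
Definition derivative_bounds (C : R) D : Prop :=
  [/\ {ae lebesgue2 R, forall z : R * R,
         z.1 \in `]0, 1[ -> z.2 \in `]0, 1[ ->
         derivable (fun s : R => fYX D s z.2) z.1 1 /\
         `|2 * fYX D z.1 z.2 + z.1 * partial_y (fYX D) z.1 z.2| <= C},
      (forall y : R, y \in `]0, 1] ->
         [lipschitz (condCDF D y x : R^o) | x in (`[0, 1] : set R^o)] /\
         [lipschitz (fYX D y x : R^o) | x in (`[0, 1] : set R^o)]) &
      {ae lebesgue2 R, forall z : R * R,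
         z.1 \in `]0, 1[ -> z.2 \in `]0, 1[ ->
         [/\ derivable (fun s : R => condCDF D z.1 s) z.2 1,
             derivable (fun s : R => fYX D z.1 s) z.2 1 &
             `|partial_x (condCDF D) z.1 z.2
               + z.1 * partial_x (fYX D) z.1 z.2| <= C]}].

Definition marginal_bounds (Cl Cu : R) D : Prop :=
  forall x : R, x \in `[0, 1] -> Cl <= fX D x <= Cu.

Definition regular_class (C0 Cs C Cl Cu : R) : set (joint_dist R) :=
  [set D | [/\ density_lipschitz_y C0 D, revenue_concave Cs D,
               interior_price D & density_C1_near_price D] /\
           derivative_bounds C D /\ marginal_bounds Cl Cu D].

End pricing.

Section iid_sample.
Context {d} {T : measurableType d} {R : realType}.

Definition cons_tuple_pair n (z : T * n.-tuple T) : n.+1.-tuple T :=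
  [the n.+1.-tuple T of z.1 :: z.2].

Lemma measurable_cons_tuple_pair n : measurable_fun setT (@cons_tuple_pair n).
Proof. by apply: measurable_cons; [exact: measurable_fst|exact: measurable_snd]. Qed.

HB.instance Definition _ n := isMeasurableFun.Build _ _ _ _
  (@cons_tuple_pair n) (@measurable_cons_tuple_pair n).

Fixpoint iid (P : probability T R) (n : nat) : probability (n.-tuple T) R :=
  match n with
  | 0 => dirac [tuple]
  | m.+1 => distribution (P \x iid P m)%E (@cons_tuple_pair m)
  end.

End iid_sample.

Section minimax.
Context {R : realType}.

(** A strategy maps a sample and a covariate value to a price.  Measurability in
    the sample at each covariate value makes the expected revenue meaningful. *)
Definition pricing_strategy n (p : n.-tuple (R * R) -> R -> R) : Prop :=
  [/\ forall s, measurable_fun (`[0, 1] : set R) (p s),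
      forall x : R, x \in `[0, 1] -> measurable_fun setT (fun s => p s x) &
      forall s x, x \in `[0, 1] -> p s x \in `[0, 1]].

Definition revenue_gap n (D : joint_dist R) (p : n.-tuple (R * R) -> R -> R)
    (x0 : R) : \bar R :=
  ((revenue D (pD D x0) x0)%:E
   - 'E_(iid (law D) n)[fun s => revenue D (p s x0) x0])%E.

Definition minimax_gap n (x0 : R) (F : set (joint_dist R)) : \bar R :=
  ereal_inf [set ereal_sup [set revenue_gap D p x0 | D in F]
            | p in @pricing_strategy n].

End minimax.

(* Main.v *)
Require Import Defs.
From HB Require Import structures.
From mathcomp Require Import all_boot all_order all_algebra.
From mathcomp Require Import all_classical all_reals all_analysis.
From mathcomp Require Import measurable_realfun ring lra.

Import Order.TTheory GRing.Theory Num.Theory.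
Import numFieldNormedType.Exports.

Local Open Scope classical_set_scope.
Local Open Scope ring_scope.

(** Le Cam's two-point method.  Put [d = n^(-1/4)].  The first law is uniform on
    the square; the second multiplies its density by [1 + a d g], where [g] is a
    bounded smooth function concentrated in a [d]-neighbourhood of the point
    [(y, x) = (1/2, x0)] and [a] is a small constant.  Localizing in both
    coordinates keeps the derivatives of the density of order [a], so the
    regularity conditions hold for small [a], while the chi-square distance of
    the two laws is of order [(a d)^2 d d = a^2 / n], so [n] observations cannot
    tell them apart.  The density at the optimal price changes by order [a d],
    hence so does the price itself, and by strong concavity of the revenue no
    price is within [o(d^2)], i.e. [o(n^(-1/2))], of optimal for both laws.

    The profile in each coordinate is the rational function [1 / (1 + u^2)]:
    it is smooth, its integral is an arctangent, and the Taylor and Lipschitz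
    estimates needed for the revenue are polynomial identities. *)

(** * Algebra of the bump profile *)

Section agnesi.
Context {R : realFieldType}.
Implicit Types (u v k : R).

Definition agnesi u : R := (1 + u ^+ 2)^-1.

(** Profile of the CDF perturbation in the valuation. It is odd, and a suitable [k] makes it vanish
    at both ends of a symmetric interval. *)
Definition ripple k u : R := u * agnesi u - k * u.

(** Derivative of [ripple k]: that of [u / (1 + u^2)] is [(1 - u^2) / (1 + u^2)^2], which is
    [2 * agnesi u ^+ 2 - agnesi u]. *)
Definition ripple' k u : R := 2 * agnesi u ^+ 2 - agnesi u - k.

Lemma agnesi_den u : 0 < 1 + u ^+ 2.
Proof. by have := sqr_ge0 u; lra. Qed.

Lemma agnesiK u : agnesi u * (1 + u ^+ 2) = 1.
Proof. by rewrite mulVf// gt_eqF// agnesi_den. Qed.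

Lemma agnesi_gt0 u : 0 < agnesi u.
Proof. by rewrite invr_gt0 agnesi_den. Qed.

Lemma agnesi_le1 u : agnesi u <= 1.
Proof. by rewrite invf_le1 ?agnesi_den// lerDl sqr_ge0. Qed.

Lemma agnesi0 : agnesi 0 = 1.
Proof. by rewrite /agnesi expr0n addr0 invr1. Qed.

Lemma agnesiN u : agnesi (- u) = agnesi u.
Proof. by rewrite /agnesi sqrrN. Qed.

Lemma le_agnesi u v : `|u| <= `|v| -> agnesi v <= agnesi u.
Proof.
move=> uv; rewrite lef_pV2 ?posrE ?agnesi_den// lerD2l.
by rewrite -(real_normK (num_real u)) -(real_normK (num_real v)) ler_sqr ?nnegrE.
Qed.

Lemma mul_agnesi_le u : `|u * agnesi u| <= 2^-1.
Proof.
have b := agnesiK u; have p := agnesi_gt0 u.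
have h1 := mulr_ge0 (ltW p) (sqr_ge0 (u - 1)).
have h2 := mulr_ge0 (ltW p) (sqr_ge0 (u + 1)).
by rewrite ler_norml; apply/andP; split; nra.
Qed.

(** The quantity is the difference quotient of [u / (1 + u^2)], as [ripple_diff] shows; the bound
    amounts to [|1 - uv| <= (1 + u^2)(1 + v^2)], a sum-of-squares inequality. *)
Lemma mul_agnesi_cross_le u v : `|(1 - u * v) * (agnesi u * agnesi v)| <= 1.
Proof.
have bu := agnesiK u; have bv := agnesiK v.
have p : 0 < agnesi u * agnesi v by rewrite mulr_gt0 ?agnesi_gt0.
have e : (agnesi u * agnesi v) * ((1 + u ^+ 2) * (1 + v ^+ 2)) = 1.
  by rewrite mulrACA bu bv mulr1.
have h1 := mulr_ge0 (ltW p) (sqr_ge0 (u + v)).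
have h2 := mulr_ge0 (ltW p) (sqr_ge0 (u * v)).
have h3 := mulr_ge0 (ltW p) (sqr_ge0 (u * v - 1)).
have h4 := mulr_ge0 (ltW p) (sqr_ge0 (u - v)).
have h5 := mulr_ge0 (ltW p) (sqr_ge0 u).
have h6 := mulr_ge0 (ltW p) (sqr_ge0 v).
by rewrite ler_norml; apply/andP; split; nra.
Qed.

Lemma agnesi_diff u v :
  agnesi u - agnesi v =
  - ((u - v) * ((u * agnesi u) * agnesi v + (v * agnesi v) * agnesi u)).
Proof.
rewrite /agnesi; field.
by rewrite !gt_eqF ?agnesi_den.
Qed.

Lemma agnesi_lip u v : `|agnesi u - agnesi v| <= `|u - v|.
Proof.
rewrite agnesi_diff normrN normrM ler_piMr//.
have := mul_agnesi_le u; have := mul_agnesi_le v.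
have := agnesi_gt0 u; have := agnesi_gt0 v.
have := agnesi_le1 u; have := agnesi_le1 v.
move: (agnesi u) (agnesi v) => a b a1 b1 a0 b0 h1 h2.
rewrite (le_trans (ler_normD _ _))// !normrM (gtr0_norm a0) (gtr0_norm b0).
rewrite !normrM !(gtr0_norm a0, gtr0_norm b0) in h1 h2.
have := normr_ge0 u; have := normr_ge0 v; nra.
Qed.

Lemma ripple_diff k u v :
  ripple k u - ripple k v = (u - v) * ((1 - u * v) * (agnesi u * agnesi v) - k).
Proof. by rewrite /ripple /agnesi; field; rewrite !gt_eqF ?agnesi_den. Qed.

Lemma ripple_lip k u v : 0 <= k <= 1 -> `|ripple k u - ripple k v| <= 2 * `|u - v|.
Proof.
move=> k01; rewrite ripple_diff normrM mulrC ler_wpM2r//.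
by have := mul_agnesi_cross_le u v; rewrite !ler_norml; lra.
Qed.

(** The remainder is exactly [(u - v)^2] times a polynomial in the bounded quantities [agnesi] and
    [u * agnesi u]; its three terms are at most 1, 1/2 and 1/2. *)
Lemma ripple_taylor k u v :
  `|ripple k u - ripple k v - ripple' k v * (u - v)| <= 2 * (u - v) ^+ 2.
Proof.
have -> : ripple k u - ripple k v - ripple' k v * (u - v) =
  - ((u - v) ^+ 2 * (2 * ((v * agnesi v) * (agnesi v * agnesi u))
      + (u * agnesi u) * agnesi v ^+ 2 - (v * agnesi v) ^+ 2 * (u * agnesi u))).
  by rewrite /ripple /ripple' /agnesi; field; rewrite !gt_eqF ?agnesi_den.
rewrite normrN normrM ger0_norm ?sqr_ge0// mulrC ler_wpM2r ?sqr_ge0//.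
have := mul_agnesi_le u; have := mul_agnesi_le v.
have := agnesi_gt0 u; have := agnesi_gt0 v.
have := agnesi_le1 u; have := agnesi_le1 v.
move: (agnesi u) (agnesi v) (u * agnesi u) (v * agnesi v).
move=> a b s t b1 a1 b0 a0 ht hs.
have ab : 0 <= b * a <= 1 by apply/andP; split; nra.
have bb : 0 <= b ^+ 2 <= 1 by apply/andP; split; nra.
have tt : 0 <= t ^+ 2 <= 1.
  by rewrite sqr_ge0 -(real_normK (num_real t)) exprn_ile1// (le_trans ht)//; lra.
rewrite (le_trans (ler_normB _ _))// (le_trans (lerD (ler_normD _ _) (lexx _)))//.
have h1 := ler_pM (normr_ge0 t) (andP ab).1 ht (andP ab).2.
have h2 := ler_pM (normr_ge0 s) (andP bb).1 hs (andP bb).2.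
have h3 := ler_pM (andP tt).1 (normr_ge0 s) (andP tt).2 hs.
rewrite (normrM 2) (normrM t) (normrM s) (normrM (t ^+ 2)).
rewrite (ger0_norm (andP ab).1) (ger0_norm (andP bb).1) (ger0_norm (andP tt).1).
by rewrite (ger0_norm (ler0n _ 2)); lra.
Qed.

Lemma ripple'_lip k u v : `|ripple' k u - ripple' k v| <= 3 * `|u - v|.
Proof.
have -> : ripple' k u - ripple' k v =
    (agnesi u - agnesi v) * (2 * (agnesi u + agnesi v) - 1).
  by rewrite /ripple'; ring.
rewrite normrM mulrC ler_pM ?normr_ge0 ?agnesi_lip//.
have := agnesi_gt0 u; have := agnesi_gt0 v.
have := agnesi_le1 u; have := agnesi_le1 v.
by rewrite ler_norml; lra.
Qed.

(** Decay is what makes the chi-square distance small: a uniform bound on [ripple'] would lose the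
    factor [d] due to localization in the valuation. *)
Lemma ripple'_le_agnesi k u : 0 <= k <= agnesi u -> `|ripple' k u| <= 2 * agnesi u.
Proof.
by have := agnesi_gt0 u; have := agnesi_le1 u; rewrite /ripple' ler_norml; nra.
Qed.

Lemma ripple'_le2 k u : 0 <= k <= 1 -> `|ripple' k u| <= 2.
Proof.
by have := agnesi_gt0 u; have := agnesi_le1 u; rewrite /ripple' ler_norml; nra.
Qed.

Lemma ripple0 k : ripple k 0 = 0.
Proof. by rewrite /ripple mul0r mulr0 subr0. Qed.

Lemma ripple'0 k : ripple' k 0 = 1 - k.
Proof. by rewrite /ripple' agnesi0; ring. Qed.

(** For [u = yloc y] the product [d * u] is [y - 1/2], at most 1/2 in size on the unit interval, and
    the cofactor [agnesi u - k] is at most 1 in size. *)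
Lemma mul_ripple_le d k u : 0 <= k <= 1 -> `|d * u| <= 2^-1 -> `|d * ripple k u| <= 1.
Proof.
move=> k01 du; have -> : d * ripple k u = (d * u) * (agnesi u - k).
  by rewrite /ripple; ring.
rewrite normrM; have : `|agnesi u - k| <= 1.
  by have := agnesi_gt0 u; have := agnesi_le1 u; rewrite ler_norml; lra.
have := normr_ge0 (d * u); have := normr_ge0 (agnesi u - k); nra.
Qed.

End agnesi.

(** * The tilted conditional law: Taylor estimates and the shift of the optimal price *)

Section tilt_algebra.
Context {R : realFieldType}.
Variables (a d x0 : R).
Implicit Types (x y z : R).

(** Subtracting this constant makes the perturbation of the conditional CDF
    vanish at [y = 0] and [y = 1], whence a density of total mass 1. *)
Definition edge : R := agnesi (2 * d)^-1.
(** The centre 1/2 is the optimal price of the uniform law, the maximizer of [y (1 - y)]. *)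
Definition yloc y : R := (y - 2^-1) / d.
Definition xloc x : R := (x - x0) / d.

(** Each differentiation costs a factor [1 / d], so the amplitude [a d^2] leaves order [a d] in the
    density and order [a] in its first derivatives. *)
Definition tilt_cdf y x : R :=
  y + a * d ^+ 2 * agnesi (xloc x) * ripple edge (yloc y).
Definition tilt_pdf y x : R :=
  1 + a * d * agnesi (xloc x) * ripple' edge (yloc y).
Definition tilt_rev y x : R := y * (1 - tilt_cdf y x).
(** The derivative of [tilt_rev] in [y]; its zero is the optimal price. *)
Definition tilt_slope y x : R := 1 - tilt_cdf y x - y * tilt_pdf y x.

(** The value [a = 0] is allowed: it gives the uniform law, so both hypotheses of the two-point
    argument belong to one family. *)
Definition small_tilt : bool := [&& 0 < d, d <= 2^-1, 0 <= a & a <= 16^-1].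

Hypothesis small : small_tilt.

Lemma edge_bounds : 0 <= edge <= 2^-1.
Proof.
have /and4P[d0 d2 a0 a16] := small.
rewrite (ltW (agnesi_gt0 _))/= /edge /agnesi lef_pV2 ?posrE ?agnesi_den//.
have h : 1 <= (2 * d)^-1 by rewrite invf_ge1; lra.
by nra.
Qed.

Let edge01 : 0 <= edge <= 1.
Proof. by have := edge_bounds; lra. Qed.

Lemma yloc0 : yloc 0 = - (2 * d)^-1.
Proof.
have /and4P[d0 d2 a0 a16] := small.
by rewrite /yloc; field; rewrite gt_eqF. Qed.

Lemma yloc1 : yloc 1 = (2 * d)^-1.
Proof.
have /and4P[d0 d2 a0 a16] := small.
by rewrite /yloc; field; rewrite gt_eqF. Qed.

Lemma mul_yloc y : d * yloc y = y - 2^-1.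
Proof.
have /and4P[d0 d2 a0 a16] := small.
by rewrite /yloc mulrC divfK// gt_eqF. Qed.

Lemma ylocB y z : d * (yloc y - yloc z) = y - z.
Proof. by rewrite mulrBr !mul_yloc; ring. Qed.

(** On the unit interval [|yloc y|] is at most [1 / (2 d)], and [agnesi] decreases in the absolute
    value of its argument. *)
Lemma edge_le_agnesi y : 0 <= y <= 1 -> 0 <= edge <= agnesi (yloc y).
Proof.
have /and4P[d0 d2 a0 a16] := small.
move=> y01; rewrite (andP edge01).1 le_agnesi//.
rewrite (gtr0_norm (x := (2 * d)^-1)); last first.
  by rewrite invr_gt0 mulr_gt0.
rewrite /yloc normrM (gtr0_norm (x := d^-1)) ?invr_gt0// invfM ler_wpM2r//.
  by rewrite invr_ge0 ltW.
by rewrite ler_norml; lra.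
Qed.

Lemma tilt_cdf0 x : tilt_cdf 0 x = 0.
Proof. by rewrite /tilt_cdf yloc0 /ripple agnesiN -/edge; ring. Qed.

Lemma tilt_cdf1 x : tilt_cdf 1 x = 1.
Proof. by rewrite /tilt_cdf yloc1 /ripple -/edge; ring. Qed.

Lemma tilt_pdf_near1 y x : `|tilt_pdf y x - 1| <= 2 * a.
Proof.
have /and4P[d0 d2 a0 a16] := small.
rewrite /tilt_pdf addrC addKr !normrM (ger0_norm a0) (gtr0_norm d0).
rewrite (gtr0_norm (agnesi_gt0 _)).
have := ripple'_le2 _ (yloc y) edge01; have := normr_ge0 (ripple' edge (yloc y)).
have := agnesi_gt0 (xloc x); have := agnesi_le1 (xloc x).
move: (agnesi _) `|_| => b c b1 b0 c0 c2.
have h1 : 0 <= d * b <= 1 by apply/andP; split; nra.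
have h2 := ler_pM (andP h1).1 c0 (andP h1).2 c2.
have := ler_wpM2l a0 h2; lra.
Qed.

Lemma tilt_pdf_bounds y x : 2^-1 <= tilt_pdf y x <= 3 / 2.
Proof.
have /and4P[d0 d2 a0 a16] := small.
by have := tilt_pdf_near1 y x; rewrite ler_norml; lra. Qed.

(** The Lipschitz constant 2 of [ripple] and the rescaling give [2 d |y - z|], and [2 d <= 1]. *)
Lemma ripple_yloc_lip y z :
  d ^+ 2 * `|ripple edge (yloc y) - ripple edge (yloc z)| <= `|y - z|.
Proof.
have /and4P[d0 d2 a0 a16] := small.
have h := ripple_lip _ (yloc y) (yloc z) edge01.
rewrite -(ylocB y z) normrM (gtr0_norm d0).
have h2 : 0 <= d * (1 - 2 * d) * `|yloc y - yloc z|.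
  by rewrite !mulr_ge0 ?(ltW d0)//; lra.
by have := ler_wpM2l (sqr_ge0 d) h; lra.
Qed.

(** Quantitative concavity. The uniform revenue has exact quadratic term [-(y - z)^2]; the
    perturbation costs at most [3 a (y - z)^2]. Strict concavity, uniqueness of the price and the
    revenue loss of a wrong price all follow from it. *)
Lemma tilt_taylor y z x : 0 <= z <= 1 ->
  tilt_rev y x <= tilt_rev z x + tilt_slope z x * (y - z)
                  - (1 - 3 * a) * (y - z) ^+ 2.
Proof.
have /and4P[d0 d2 a0 a16] := small.
move=> z01; set b := agnesi (xloc x).
have b0 : 0 <= b := ltW (agnesi_gt0 _); have b1 : b <= 1 := agnesi_le1 _.
set T := ripple edge (yloc y) - ripple edge (yloc z)
  - ripple' edge (yloc z) * (yloc y - yloc z).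
set L := ripple edge (yloc y) - ripple edge (yloc z).
have hT : d ^+ 2 * `|T| <= 2 * (y - z) ^+ 2.
  rewrite -(ylocB y z) exprMn mulrCA ler_wpM2l ?sqr_ge0//.
  exact: ripple_taylor.
have hL : d ^+ 2 * `|L| <= `|y - z| := ripple_yloc_lip y z.
(* Exact expansion: the Taylor remainder [T] of the profile is weighted by [z], and its increment
   [L] by [y - z]. They contribute 2 and 1 to the constant 3. *)
have -> : tilt_rev y x = tilt_rev z x + tilt_slope z x * (y - z) - (y - z) ^+ 2
    - a * b * (z * (d ^+ 2 * T) + (y - z) * (d ^+ 2 * L)).
  have e := ylocB y z.
  rewrite /tilt_rev /tilt_slope /tilt_cdf /tilt_pdf -/b /T /L.
  have -> : y = z + d * (yloc y - yloc z) by rewrite e; ring.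
  rewrite (_ : yloc (z + d * (yloc y - yloc z)) = yloc y); last first.
    by rewrite e addrC subrK.
  by move: (ripple _ _) (ripple _ _) (ripple' _ _) => D E F; ring.
have : - (a * b * (z * (d ^+ 2 * T) + (y - z) * (d ^+ 2 * L)))
    <= 3 * a * (y - z) ^+ 2; last by lra.
rewrite (le_trans (ler_norm _))// normrN !normrM (ger0_norm a0) (ger0_norm b0).
rewrite -mulrA [3 * a]mulrC -[leRHS]mulrA ler_wpM2l//.
have : `|z * (d ^+ 2 * T) + (y - z) * (d ^+ 2 * L)| <= 3 * (y - z) ^+ 2.
  rewrite (le_trans (ler_normD _ _))// (normrM z) (normrM (y - z)) !(normrM (d ^+ 2)).
  rewrite (ger0_norm (sqr_ge0 d)).
  rewrite (ger0_norm (andP z01).1).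
  have h1 := ler_wpM2l (normr_ge0 (y - z)) hL.
  have h2 : z * (d ^+ 2 * `|T|) <= 2 * (y - z) ^+ 2.
    have : 0 <= d ^+ 2 * `|T| by rewrite mulr_ge0 ?sqr_ge0.
    by nra.
  move: h1; rewrite -expr2 real_normK ?num_real//; lra.
by have := normr_ge0 (z * (d ^+ 2 * T) + (y - z) * (d ^+ 2 * L)); nra.
Qed.

(** Turns a nonzero slope at the uniform price into a distance to the tilted price. *)
Lemma tilt_slope_lip y z x : 0 <= z <= 1 ->
  `|tilt_slope y x - tilt_slope z x| <= 3 * `|y - z|.
Proof.
have /and4P[d0 d2 a0 a16] := small.
move=> z01; set b := agnesi (xloc x).
have b0 : 0 <= b := ltW (agnesi_gt0 _); have b1 : b <= 1 := agnesi_le1 _.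
set L := ripple edge (yloc y) - ripple edge (yloc z).
set M := ripple' edge (yloc y) - ripple' edge (yloc z).
have yz : `|y - z| = d * `|yloc y - yloc z|.
  by rewrite -(ylocB y z) normrM (gtr0_norm d0).
have hL : d ^+ 2 * `|L| <= `|y - z| := ripple_yloc_lip y z.
have hM : d * `|M| <= 3 * `|y - z|.
  rewrite yz mulrCA ler_wpM2l ?(ltW d0)//; exact: ripple'_lip.
have hD : d * `|ripple' edge (yloc y)| <= 1.
  have := ripple'_le2 _ (yloc y) edge01.
  have := normr_ge0 (ripple' edge (yloc y)); nra.
have -> : tilt_slope y x - tilt_slope z x = - (2 * (y - z))
   - a * b * (d ^+ 2 * L + (y - z) * (d * ripple' edge (yloc y)) + z * (d * M)).
  rewrite /tilt_slope /tilt_cdf /tilt_pdf -/b /L /M.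
  by move: (ripple _ _) (ripple _ _) (ripple' _ _) (ripple' _ _) => D E F G; ring.
set X := (X in a * b * X).
(* The three terms give 1, 1 and 3; with [a <= 1/16] the total constant [2 + 5/16] stays below 3. *)
have hX : `|X| <= 5 * `|y - z|.
  rewrite /X (le_trans (ler_normD _ _))// (le_trans (lerD (ler_normD _ _) (lexx _)))//.
  rewrite (normrM (d ^+ 2)) (ger0_norm (sqr_ge0 d)) (normrM (y - z)) (normrM z).
  rewrite !(normrM d) (gtr0_norm d0) (ger0_norm (andP z01).1).
  have := ler_wpM2l (normr_ge0 (y - z)) hD.
  have : z * (d * `|M|) <= 3 * `|y - z|; last by lra.
  have : 0 <= d * `|M| by rewrite mulr_ge0 ?(ltW d0).
  by nra.
rewrite (le_trans (ler_normB _ _))// normrN !normrM (ger0_norm a0) (ger0_norm b0).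
rewrite (ger0_norm (ler0n _ 2)).
have h : a * b * `|X| <= 16^-1 * `|X|.
  by rewrite ler_wpM2r//; nra.
by have := normr_ge0 X; lra.
Qed.

(** The profile vanishes at its centre, so the tilt leaves the CDF at 1/2 unchanged and acts on the
    slope through the density alone. *)
Lemma tilt_slope_half x :
  tilt_slope 2^-1 x = - (a * d * agnesi (xloc x) * (1 - edge) / 2).
Proof.
rewrite /tilt_slope /tilt_cdf /tilt_pdf.
have -> : yloc 2^-1 = 0 by rewrite /yloc subrr mul0r.
by rewrite ripple0 ripple'0; field.
Qed.

(** At [x0] the slope at 1/2 has size at least [a d / 4], because [edge <= 1/2]; dividing by the
    Lipschitz constant 3 gives the 12. *)
Lemma tilt_price_shift p : 0 <= p <= 1 -> tilt_slope p x0 = 0 ->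
  a * d / 12 <= `|p - 2^-1|.
Proof.
have /and4P[d0 d2 a0 a16] := small.
move=> p01 sp; have := tilt_slope_lip 2^-1 p x0 p01; rewrite sp subr0.
rewrite tilt_slope_half normrN distrC.
have -> : xloc x0 = 0 by rewrite /xloc subrr mul0r.
rewrite agnesi0 mulr1 ger0_norm; have := edge_bounds; have := mulr_ge0 a0 (ltW d0).
  by nra.
by move=> ad e; rewrite !mulr_ge0//; lra.
Qed.

End tilt_algebra.

(** * Derivatives and integrals of the tilted density *)

Section tilt_calculus.
Context {R : realType}.
Variables (a d x0 : R).
Implicit Types (u x y z : R).

Definition agnesi' u : R := - (2 * u * agnesi u ^+ 2).

Definition ripple'' u : R := (4 * agnesi u - 1) * agnesi' u.

Lemma is_derive_agnesi u : is_derive u 1 agnesi (agnesi' u).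
Proof.
have e : 1 + u ^+ 2 != 0 by rewrite gt_eqF// agnesi_den.
have h : is_derive u 1 (fun s : R => 1 + s ^+ 2) (2 * u).
  by apply: is_derive_eq; rewrite /GRing.scale/=; ring.
apply: (is_derive_eq (@is_deriveV _ (fun s : R => 1 + s ^+ 2) _ _ _ e h)).
by rewrite /agnesi' /agnesi /GRing.scale/=; field.
Qed.

Lemma is_derive_affine c k u : is_derive u 1 (fun s : R => (s - c) / k) k^-1.
Proof.
by apply: is_derive_eq; rewrite /GRing.scale/=; ring.
Qed.

Lemma is_derive_ripple k u : is_derive u 1 (ripple k) (ripple' k u).
Proof.
have ? := is_derive_agnesi u.
have -> : ripple k = (fun s : R => s * agnesi s - k * s) by [].
apply: is_derive_eq.
rewrite /GRing.scale/= /agnesi' /ripple' /agnesi; field.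
by rewrite gt_eqF// agnesi_den.
Qed.

Lemma is_derive_ripple' k u : is_derive u 1 (ripple' k) (ripple'' u).
Proof.
have ? := is_derive_agnesi u.
have -> : ripple' k = (fun s : R => 2 * agnesi s ^+ 2 - agnesi s - k) by [].
apply: is_derive_eq.
by rewrite /GRing.scale/= /ripple''; ring.
Qed.

Lemma agnesi'_le1 u : `|agnesi' u| <= 1.
Proof.
have -> : agnesi' u = - (2 * ((u * agnesi u) * agnesi u)) by rewrite /agnesi'; ring.
rewrite normrN normrM (normrM (u * agnesi u)) (ger0_norm (ler0n _ 2)).
rewrite (gtr0_norm (agnesi_gt0 u)).
have := mul_agnesi_le u; have := agnesi_gt0 u; have := agnesi_le1 u.
have := normr_ge0 (u * agnesi u); nra.
Qed.

Lemma ripple''_le3 u : `|ripple'' u| <= 3.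
Proof.
rewrite /ripple'' normrM -[leRHS]mulr1 ler_pM ?agnesi'_le1//.
by have := agnesi_gt0 u; have := agnesi_le1 u; rewrite ler_norml; lra.
Qed.

Lemma continuous_agnesi : continuous (@agnesi R).
Proof.
move=> u; apply/differentiable_continuous/derivable1_diffP.
by have [] := is_derive_agnesi u.
Qed.

Lemma continuous_agnesi' : continuous agnesi'.
Proof.
move=> u; apply: cvgN; apply: cvgM.
  by apply: cvgM; [exact: cvg_cst|exact: cvg_id].
rewrite /= expr2; under eq_fun do rewrite expr2.
by apply: cvgM; exact: continuous_agnesi.
Qed.

Lemma continuous_ripple' k : continuous (@ripple' R k).
Proof.
move=> u; apply/differentiable_continuous/derivable1_diffP.
by have [] := is_derive_ripple' k u.
Qed.

Lemma continuous_ripple'' : continuous ripple''.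
Proof.
move=> u; apply: cvgM; last exact: continuous_agnesi'.
apply: cvgB; last exact: cvg_cst.
by apply: cvgM; [exact: cvg_cst|exact: continuous_agnesi].
Qed.

Lemma continuous_affine c k : continuous (fun s : R => (s - c) / k).
Proof.
move=> u; apply/differentiable_continuous/derivable1_diffP.
by have [] := is_derive_affine c k u.
Qed.

Lemma integral_is_derive (f F : R -> R) (s t : R) : s < t -> continuous f ->
  (forall x, is_derive x 1 F (f x)) ->
  (\int[lebesgue_measure]_(x in `[s, t]) (f x)%:E = (F t - F s)%:E)%E.
Proof.
move=> st cf dF; have cF : continuous F.
  move=> x; apply/differentiable_continuous/derivable1_diffP.
  by have [] := dF x.
rewrite (@continuous_FTC2 _ _ F)//.
- exact: continuous_subspaceT.
- split.
  + by move=> x _; have [] := dF x.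
  + by apply: cvg_at_right_filter; exact: cF.
  + by apply: cvg_at_left_filter; exact: cF.
- by move=> x _; rewrite derive1E; have [_ ->] := dF x.
Qed.

Lemma continuous_tensor (c : R) (f g : R -> R) : continuous f -> continuous g ->
  continuous (fun w : R * R => c * f w.2 * g w.1).
Proof.
move=> cf cg w; apply: cvgM; first apply: cvgM; first exact: cvg_cst.
  by apply: continuous_comp; [exact: cvg_snd|exact: cf].
by apply: continuous_comp; [exact: cvg_fst|exact: cg].
Qed.

Local Notation cdf := (tilt_cdf a d x0).
Local Notation pdf := (tilt_pdf a d x0).
Local Notation yloc := (yloc d).
Local Notation xloc := (xloc d x0).
Local Notation edge := (edge d).

Hypothesis small : small_tilt a d.

Lemma is_derive_tilt_cdf_y y x : is_derive y 1 (cdf ^~ x) (pdf y x).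
Proof.
have /and4P[d0 d2 a0 a16] := small.
have ? := is_derive1_comp (is_derive_ripple edge (yloc y)) (is_derive_affine 2^-1 d y).
have -> : cdf ^~ x = (fun s : R => s + (a * d ^+ 2 * agnesi (xloc x)) *
   (ripple edge \o (fun s : R => (s - 2^-1) / d)) s) by [].
apply: is_derive_eq; rewrite /GRing.scale/= /tilt_pdf.
by field; rewrite gt_eqF.
Qed.

Lemma is_derive_tilt_pdf_y y x :
  is_derive y 1 (pdf ^~ x) (a * agnesi (xloc x) * ripple'' (yloc y)).
Proof.
have /and4P[d0 d2 a0 a16] := small.
have ? := is_derive1_comp (is_derive_ripple' edge (yloc y)) (is_derive_affine 2^-1 d y).
have -> : pdf ^~ x = (fun s : R => 1 + (a * d * agnesi (xloc x)) *
   (ripple' edge \o (fun s : R => (s - 2^-1) / d)) s) by [].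
apply: is_derive_eq; rewrite /GRing.scale/=.
by field; rewrite gt_eqF.
Qed.

Lemma is_derive_tilt_cdf_x y x :
  is_derive x 1 (cdf y) (a * d * agnesi' (xloc x) * ripple edge (yloc y)).
Proof.
have /and4P[d0 d2 a0 a16] := small.
have ? := is_derive1_comp (is_derive_agnesi (xloc x)) (is_derive_affine x0 d x).
have -> : cdf y = (fun s : R => y + (a * d ^+ 2 *
   (agnesi \o (fun s : R => (s - x0) / d)) s) * ripple edge (yloc y)) by [].
apply: is_derive_eq; rewrite /GRing.scale/=.
by field; rewrite gt_eqF.
Qed.

Lemma is_derive_tilt_pdf_x y x :
  is_derive x 1 (pdf y) (a * agnesi' (xloc x) * ripple' edge (yloc y)).
Proof.
have /and4P[d0 d2 a0 a16] := small.
have ? := is_derive1_comp (is_derive_agnesi (xloc x)) (is_derive_affine x0 d x).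
have -> : pdf y = (fun s : R => 1 + (a * d *
   (agnesi \o (fun s : R => (s - x0) / d)) s) * ripple' edge (yloc y)) by [].
apply: is_derive_eq; rewrite /GRing.scale/=.
by field; rewrite gt_eqF.
Qed.

Lemma C1_tilt_pdf : C1_on setT pdf.
Proof.
move=> z _; split.
- by have [] := is_derive_tilt_pdf_y z.1 z.2.
- by have [] := is_derive_tilt_pdf_x z.1 z.2.
- have -> : (fun w : R * R => partial_y pdf w.1 w.2)
      = (fun w => a * (agnesi \o xloc) w.2 * (ripple'' \o yloc) w.1).
    apply/funext => w; rewrite /partial_y derive1E.
    by have [_ ->] := is_derive_tilt_pdf_y w.1 w.2.
  apply: continuous_tensor => u; apply: continuous_comp;
    by [exact: continuous_affine|exact: continuous_agnesi|exact: continuous_ripple''].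
- have -> : (fun w : R * R => partial_x pdf w.1 w.2)
      = (fun w => a * (agnesi' \o xloc) w.2 * (ripple' edge \o yloc) w.1).
    apply/funext => w; rewrite /partial_x derive1E.
    by have [_ ->] := is_derive_tilt_pdf_x w.1 w.2.
  apply: continuous_tensor => u; apply: continuous_comp;
    by [exact: continuous_affine|exact: continuous_agnesi'|exact: continuous_ripple'].
Qed.

Lemma continuous_tilt_pdf_y x : continuous (pdf ^~ x).
Proof.
move=> y; apply/differentiable_continuous/derivable1_diffP.
by have [] := is_derive_tilt_pdf_y y x.
Qed.

Lemma continuous_tilt_cdf_y x : continuous (cdf ^~ x).
Proof.
move=> y; apply/differentiable_continuous/derivable1_diffP.
by have [] := is_derive_tilt_cdf_y y x.
Qed.

Lemma integral_tilt_pdf y x : 0 <= y ->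
  (\int[lebesgue_measure]_(u in `[0%R, y]) (pdf u x)%:E = (cdf y x)%:E)%E.
Proof.
rewrite le_eqVlt => /predU1P[<-|y0].
  by rewrite set_itv1 integral_set1 (tilt_cdf0 _ _ _ small).
rewrite (integral_is_derive (pdf ^~ x) (cdf ^~ x) 0 y y0
  (continuous_tilt_pdf_y x) (is_derive_tilt_cdf_y ^~ x)).
by rewrite (tilt_cdf0 _ _ _ small) subr0.
Qed.

Lemma measurable_tilt_pdf : measurable_fun setT (fun z : R * R => pdf z.1 z.2).
Proof.
have m (f : R -> R) : continuous f -> measurable_fun setT f.
  exact: continuous_measurable_fun.
apply: measurable_funD => //; apply: measurable_funM.
  apply: measurable_funM => //; apply: (measurableT_comp (m _ continuous_agnesi)).
  exact: (measurableT_comp (m _ (continuous_affine x0 d)) measurable_snd).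
apply: (measurableT_comp (m _ (continuous_ripple' edge))).
exact: (measurableT_comp (m _ (continuous_affine 2^-1 d)) measurable_fst).
Qed.

(** As functions of [x], both the tilted CDF and the tilted density have this shape. *)
Lemma lipschitz_agnesi_xloc (c m k : R) :
  [lipschitz (c + m * agnesi (xloc x) * k : R^o) | x in (`[0, 1] : set R^o)].
Proof.
have /and4P[d0 d2 a0 a16] := small.
have pf : ProperFilter (globally ((`[0, 1] : set R^o) `*` (`[0, 1] : set R^o))).
  apply: (@globally_properfilter _ _ (0, 0)).
  by split => /=; rewrite in_itv/= lexx ler01.
apply: (@klipschitzW _ _ _ (`|m * k| / d)) => -[x x'] /= _.
have -> : c + m * agnesi (xloc x) * k - (c + m * agnesi (xloc x') * k)
  = (m * k) * (agnesi (xloc x) - agnesi (xloc x')) by ring.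
rewrite normrM -mulrA ler_wpM2l//.
rewrite (le_trans (agnesi_lip _ _))//.
have -> : xloc x - xloc x' = d^-1 * (x - x') by rewrite /xloc; field; rewrite gt_eqF.
by rewrite normrM gtr0_norm// invr_gt0.
Qed.

(** The linear part of the perturbation integrates to zero, and its square is dominated by a
    multiple of [agnesi (yloc y)]; rescaling the valuation supplies the third power of [d]. *)
Lemma integral_tilt_pdf_sqr x :
  (\int[lebesgue_measure]_(y in `[0%R, 1%R]) (pdf y x ^+ 2)%:E
    <= (1 + 16 * a ^+ 2 * d ^+ 3 * agnesi (xloc x))%:E)%E.
Proof.
have /and4P[d0 d2 a0 a16] := small.
pose m : R := 4 * a ^+ 2 * d ^+ 2 * agnesi (xloc x).
have m0 : 0 <= m by rewrite /m !mulr_ge0 ?sqr_ge0// ltW// agnesi_gt0.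
have ca : continuous (fun y => agnesi (yloc y)).
  move=> y; apply: continuous_comp; first exact: continuous_affine.
  exact: continuous_agnesi.
(* A majorant of [pdf^2 = 2 pdf - 1 + (pdf - 1)^2] with an elementary antiderivative;
   [ripple'_le_agnesi] bounds the last square. *)
pose h y := 2 * pdf y x - 1 + m * agnesi (yloc y).
have ch : continuous h.
  move=> y; apply: cvgD; last by apply: cvgM; [exact: cvg_cst|exact: ca].
  apply: cvgB; last exact: cvg_cst.
  by apply: cvgM; [exact: cvg_cst|exact: continuous_tilt_pdf_y].
apply: (@le_trans _ _ (\int[lebesgue_measure]_(y in `[0%R, 1%R]) (h y)%:E)%E).
  apply: ge0_le_integral => //=.
  - by move=> y _; rewrite lee_fin sqr_ge0.
  - apply/measurable_EFinP/measurable_funTS; apply: measurable_funX.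
    apply: continuous_measurable_fun; exact: continuous_tilt_pdf_y.
  - by apply/measurable_EFinP/measurable_funTS; exact: continuous_measurable_fun.
  - move=> y; rewrite in_itv/= lee_fin => y01.
    have := ripple'_le_agnesi _ _ (edge_le_agnesi _ _ small _ y01).
    rewrite /h /tilt_pdf /m.
    have b0 := agnesi_gt0 (xloc x); have b1 := agnesi_le1 (xloc x).
    have q0 := agnesi_gt0 (yloc y); have q1 := agnesi_le1 (yloc y).
    move: (agnesi (xloc x)) (agnesi (yloc y)) (ripple' _ _) b0 b1 q0 q1 => b q e.
    move=> b0 b1 q0 q1 eq.
    have e2 : e ^+ 2 <= 4 * q.
      rewrite -(real_normK (num_real e)); have := normr_ge0 e; nra.
    have : (a * d) ^+ 2 * (b ^+ 2 * e ^+ 2) <= (a * d) ^+ 2 * (b * (4 * q)).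
      by rewrite ler_wpM2l ?sqr_ge0// ler_pM ?sqr_ge0//; nra.
    by nra.
have dF y : is_derive y 1 (fun y => 2 * cdf y x - y + m * d * atan (yloc y)) (h y).
  rewrite /h; have ? := is_derive_tilt_cdf_y y x.
  have ? := is_derive1_comp (is_derive1_atan (yloc y)) (is_derive_affine 2^-1 d y).
  have -> : (fun y => 2 * cdf y x - y + m * d * atan (yloc y)) = (fun y =>
    2 * (cdf ^~ x) y - y + m * d * (atan \o (fun s : R => (s - 2^-1) / d)) y) by [].
  apply: is_derive_eq; rewrite /GRing.scale/= /agnesi.
  by field; rewrite !gt_eqF ?agnesi_den.
rewrite (integral_is_derive h _ 0 1 ltr01 ch dF).
rewrite lee_fin (tilt_cdf1 _ _ _ small) (tilt_cdf0 _ _ _ small).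
have md0 : 0 <= m * d by rewrite mulr_ge0// ltW.
have -> : 16 * a ^+ 2 * d ^+ 3 * agnesi (xloc x) = m * d * 4 by rewrite /m; ring.
(* Each arctangent is bounded by [pi / 2 < 2] in size, so their difference is at most 4. *)
have := atan_ltpi2 (yloc 1); have := atan_gtNpi2 (yloc 0).
have /andP[_] := @pihalf_02 R => p2 u0 u1.
have : m * d * (atan (yloc 1) - atan (yloc 0)) <= m * d * 4.
  by rewrite ler_wpM2l//; lra.
by lra.
Qed.

(** The arctangent bound in the covariate direction, which supplies the fourth power of [d]. *)
Lemma integral_one_agnesi (m : R) : 0 <= m ->
  (\int[lebesgue_measure]_(x in `[0%R, 1%R]) (1 + m * agnesi (xloc x))%:E
    <= (1 + m * d * 4)%:E)%E.
Proof.
have /and4P[d0 d2 a0 a16] := small.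
move=> m0; have ca : continuous (fun x => 1 + m * agnesi (xloc x)).
  move=> x; apply: cvgD; first exact: cvg_cst.
  apply: cvgM; first exact: cvg_cst.
  by apply: continuous_comp; [exact: continuous_affine|exact: continuous_agnesi].
have dF x : is_derive x 1 (fun x => x + m * d * atan (xloc x))
    (1 + m * agnesi (xloc x)).
  have ? := is_derive1_comp (is_derive1_atan (xloc x)) (is_derive_affine x0 d x).
  have -> : (fun x => x + m * d * atan (xloc x))
    = (fun x => x + m * d * (atan \o (fun s : R => (s - x0) / d)) x) by [].
  apply: is_derive_eq; rewrite /GRing.scale/= /agnesi.
  by field; rewrite !gt_eqF ?agnesi_den.
rewrite (integral_is_derive _ _ 0 1 ltr01 ca dF).
rewrite lee_fin; have md0 : 0 <= m * d by rewrite mulr_ge0// ltW.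
have := atan_ltpi2 (xloc 1); have := atan_gtNpi2 (xloc 0).
have /andP[_] := @pihalf_02 R => p2 u0 u1.
have : m * d * (atan (xloc 1) - atan (xloc 0)) <= m * d * 4.
  by rewrite ler_wpM2l//; lra.
by lra.
Qed.

End tilt_calculus.

(** * Integration against a measure given by a density *)

Section density.
Context {d1 d2} {T1 : measurableType d1} {T2 : measurableType d2} {R : realType}.
Local Open Scope ereal_scope.
Import HBNNSimple.

(** [lebesgue_measure] lives on a copy of [R] whose measurable structure is not
    convertible to the one of [R]; taking [phi] the identity bridges the two. *)
Lemma ge0_integral_density (mu : {measure set T1 -> \bar R})
    (P : {measure set T2 -> \bar R}) (phi : T1 -> T2) (w : T1 -> R) :
    measurable_fun setT phi -> measurable_fun setT w -> (forall x, 0 <= w x)%R ->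
    (forall A, measurable A -> P A = \int[mu]_(x in phi @^-1` A) (w x)%:E) ->
  forall G : T2 -> \bar R, measurable_fun setT G -> (forall x, 0 <= G x) ->
    \int[P]_x G x = \int[mu]_x ((w x)%:E * G (phi x)).
Proof.
move=> mphi mw w0 PE G mG G0.
pose h := nnsfun_approx measurableT mG.
have hG x : EFin \o h ^~ x @ \oo --> G x by exact: cvg_nnsfun_approx.
have ndh x : {homo h ^~ x : m n / (m <= n)%N >-> (m <= n)%R}.
  by move=> m n mn; exact/lefP/nd_nnsfun_approx.
have mwE : measurable_fun setT (EFin \o w) by exact/measurable_EFinP.
have mh n : measurable_fun setT (EFin \o (h n \o phi)).
  by apply/measurable_EFinP; exact: measurableT_comp.
(* Monotone convergence on both sides reduces the identity to the simple functions [h n], hence to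
   indicators, where the hypothesis on [P] applies. *)
transitivity (limn (fun n => \int[P]_x (h n x)%:E)).
  rewrite -monotone_convergence//.
  - by apply: eq_integral => x _; apply/esym/cvg_lim => //; exact: hG.
  - by move=> n; exact/measurable_EFinP.
  - by move=> n x _; rewrite lee_fin.
  - by move=> x _ m n mn; rewrite lee_fin; exact: ndh.
transitivity (limn (fun n => \int[mu]_x ((w x)%:E * (h n (phi x))%:E))); last first.
  rewrite -monotone_convergence//.
  - by apply: eq_integral => x _; apply/cvg_lim => //; apply: cvgeZl => //; exact: hG.
  - by move=> n; apply: emeasurable_funM => //; exact: mh.
  - by move=> n x _; rewrite mule_ge0 ?lee_fin.
  - by move=> x _ m n mn; rewrite lee_wpmul2l ?lee_fin//; exact: ndh.
congr (limn _); apply/funext => n.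
have mr r : measurable_fun setT (fun x => (\1_(h n @^-1` [set r]) (phi x) : R)).
  by apply: measurableT_comp => //; exact: measurable_indic.
rewrite integralT_nnsfun sintegralE.
transitivity (\int[mu]_x (\sum_(r \in range (h n))
    (w x)%:E * (r * \1_(h n @^-1` [set r]) (phi x))%:E)); last first.
  apply: eq_integral => x _; rewrite -ge0_mule_fsumr; last first.
    by move=> r; rewrite EFinM; exact: nnfun_muleindic_ge0.
  by rewrite fsumEFin// -fimfunE.
rewrite ge0_integral_fsum//; last 2 first.
- move=> r; apply: emeasurable_funM => //; apply/measurable_EFinP.
  exact: measurable_funM.
- by move=> r x _; rewrite mule_ge0 ?lee_fin//;
  exact: nnfun_muleindic_ge0.
apply: eq_fsbigr => r; rewrite inE => -[x _ <-].
rewrite PE// integral_mkcond epatch_indic -ge0_integralZl//.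
- by apply: eq_integral => y _; rewrite EFinM muleCA.
- by apply: emeasurable_funM => //; apply/measurable_EFinP; exact: mr.
- by move=> y _; rewrite mule_ge0 ?lee_fin.
- by rewrite lee_fin.
Qed.

End density.

(** * Le Cam's two-point inequality for i.i.d. samples *)

Section le_cam.
Context {d} {T : measurableType d} {R : realType}.
Local Open Scope ereal_scope.
Variables (P0 P1 : probability T R) (rho : T -> R) (K : R).
Hypothesis mrho : measurable_fun setT rho.
Hypothesis rho0 : forall z, (0 <= rho z)%R.
Hypothesis P1E : forall G : T -> \bar R, measurable_fun setT G ->
  (forall z, 0 <= G z) -> \int[P1]_z G z = \int[P0]_z ((rho z)%:E * G z).
Hypothesis rho2 : \int[P0]_z (rho z ^+ 2)%:E <= K%:E.

Lemma integral_iidS (P : probability T R) n (A : n.+1.-tuple T -> \bar R) :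
  measurable_fun setT A -> (forall s, 0 <= A s) ->
  \int[iid P n.+1]_s A s =
  \int[P]_z \int[iid P n]_s A (cons_tuple_pair (z, s)).
Proof.
move=> mA A0; rewrite [LHS]ge0_integral_pushforward//=.
rewrite preimage_setT fubini_tonelli1//.
by apply: measurableT_comp => //; exact: measurable_cons_tuple_pair.
Qed.

Lemma measurable_iid_section (P : probability T R) n (A : n.+1.-tuple T -> \bar R) :
  measurable_fun setT A -> (forall s, 0 <= A s) ->
  measurable_fun setT (fun z => \int[iid P n]_s A (cons_tuple_pair (z, s))).
Proof.
move=> mA A0.
apply: (measurable_fun_fubini_tonelli_F (A \o @cons_tuple_pair _ T n)).
  by apply: measurableT_comp => //; exact: measurable_cons_tuple_pair.
by move=> z; exact: A0.
Qed.

(** The induction peels off one observation at a time, the weight [w] absorbing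
    its likelihood ratio, so the product density is never formed; the base case
    is [min(1, w) >= w - w^2 / 4]. *)
Lemma le_cam_two_points n (w : R) (A B : n.-tuple T -> R) :
  (0 <= w)%R ->
  measurable_fun setT A -> measurable_fun setT B ->
  (forall s, 0 <= A s)%R -> (forall s, 0 <= B s)%R ->
  (forall s, 1 <= A s + B s)%R ->
  w%:E <= \int[iid P0 n]_s (A s)%:E + w%:E * \int[iid P1 n]_s (B s)%:E
          + (w ^+ 2 * K ^+ n / 4)%:E.
Proof.
have K0 : (0 <= K)%R.
  rewrite -lee_fin; apply: le_trans rho2; apply: integral_ge0 => z _.
  by rewrite lee_fin sqr_ge0.
elim: n w A B => [|n IH] w A B w0 mA mB A0 B0 AB.
  rewrite /= !integral_dirac//; try exact/measurable_EFinP.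
  rewrite !diracT !mul1e expr0 mulr1.
  have := AB [tuple]; have := A0 [tuple]; have := B0 [tuple].
  (* For [w > 1] the needed bound [1 >= w - w^2 / 4] is this square. *)
  have q0 : (0 <= (w - 2) ^+ 2)%R by rewrite sqr_ge0.
  rewrite -EFinM -!EFinD lee_fin.
  move: (A _) (B _) => x y y0 x0 xy; have [w1|w1] := lerP w 1; nra.
rewrite !integral_iidS; try by [exact/measurable_EFinP|move=> s; rewrite lee_fin].
set FA := fun z => \int[iid P0 n]_s (A (cons_tuple_pair (z, s)))%:E.
set FB := fun z => \int[iid P1 n]_s (B (cons_tuple_pair (z, s)))%:E.
have FA0 z : 0 <= FA z by apply: integral_ge0 => s _; rewrite lee_fin.
have FB0 z : 0 <= FB z by apply: integral_ge0 => s _; rewrite lee_fin.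
have mFA : measurable_fun setT FA.
  apply: (measurable_iid_section P0 n (EFin \o A)); first exact/measurable_EFinP.
  by move=> s; rewrite lee_fin.
have mFB : measurable_fun setT FB.
  apply: (measurable_iid_section P1 n (EFin \o B)); first exact/measurable_EFinP.
  by move=> s; rewrite lee_fin.
have mc z : measurable_fun setT (fun s : n.-tuple T => cons_tuple_pair (z, s)).
  apply: measurableT_comp; last exact: measurable_pair1.
  exact: measurable_cons_tuple_pair.
rewrite P1E//.
set c := (w ^+ 2 * K ^+ n / 4)%R.
have c0 : (0 <= c)%R by rewrite /c !mulr_ge0 ?exprn_ge0 ?sqr_ge0.
(* With the first observation [z] fixed, the induction hypothesis is used at weight [w * rho z].
   Integrating the last term over [z] yields the extra factor [K]. *)
have key z : (w * rho z)%:E <=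
    FA z + w%:E * ((rho z)%:E * FB z) + c%:E * (rho z ^+ 2)%:E.
  rewrite muleA -!EFinM.
  have -> : (c * rho z ^+ 2 = (w * rho z) ^+ 2 * K ^+ n / 4)%R by rewrite /c; ring.
  apply: IH => //; first by rewrite mulr_ge0.
  - exact: measurableT_comp.
  - exact: measurableT_comp.
have mrhoE : measurable_fun setT (EFin \o rho) by exact/measurable_EFinP.
have mrho2 : measurable_fun setT (fun z => (rho z ^+ 2)%:E).
  by apply/measurable_EFinP; exact: measurable_funX.
have mrFB : measurable_fun setT (fun z => (rho z)%:E * FB z).
  exact: emeasurable_funM.
have rFB0 z : 0 <= (rho z)%:E * FB z by rewrite mule_ge0 ?lee_fin.
(* The change of measure applied to the constant 1. It lets [w] be written as the integral of
   [w * rho], so that [key] can be integrated. *)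
have rho1 : \int[P0]_z (rho z)%:E = 1.
  transitivity (\int[P1]_z (cst 1 z)).
    by rewrite P1E//; apply: eq_integral => z _; rewrite mule1.
  by rewrite integral_cst// mul1e; exact: probability_setT.
have wE : w%:E = \int[P0]_z (w * rho z)%:E.
  under eq_integral do rewrite EFinM.
  by rewrite ge0_integralZl ?rho1 ?mule1// => z _; rewrite lee_fin.
rewrite [leLHS]wE.
apply: (@le_trans _ _ (\int[P0]_z (FA z + w%:E * ((rho z)%:E * FB z)
    + c%:E * (rho z ^+ 2)%:E))).
  apply: ge0_le_integral => //.
  - by move=> z _; rewrite lee_fin mulr_ge0.
  - by apply/measurable_EFinP; exact: measurable_funM.
  - by apply: emeasurable_funD; [apply: emeasurable_funD => //|];
      exact: measurable_funeM.
rewrite ge0_integralD//; last 4 first.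
- by move=> z _; rewrite adde_ge0// mule_ge0 ?lee_fin.
- by apply: emeasurable_funD => //; exact: measurable_funeM.
- by move=> z _; rewrite mule_ge0 ?lee_fin ?sqr_ge0.
- exact: measurable_funeM.
rewrite ge0_integralD//; last 2 first.
- by move=> z _; rewrite mule_ge0 ?lee_fin.
- exact: measurable_funeM.
rewrite ge0_integralZl// leeD2l//.
rewrite ge0_integralZl//; last by move=> z _; rewrite lee_fin sqr_ge0.
have -> : (w ^+ 2 * K ^+ n.+1 / 4 = c * K)%R by rewrite [(K ^+ _)%R]exprS /c; ring.
by rewrite [leRHS]EFinM lee_wpmul2l ?lee_fin.
Qed.

End le_cam.

(** * The tilted joint law, its optimal price and its regularity *)

Section tilt_law.
Context {R : realType}.
Variables (a d x0 : R).
Local Notation pdf := (tilt_pdf a d x0).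
Local Notation S := ((`[0, 1] `*` `[0, 1]) : set (R * R)).

Lemma measurable_square : measurable S.
Proof. exact: measurableX. Qed.

Lemma integral_square (g : R * R -> \bar R) : measurable_fun setT g ->
  (forall z, 0 <= g z)%E ->
  (\int[lebesgue2 R]_(z in S) g z =
   \int[lebesgue_measure]_(x in `[0%R, 1%R])
     \int[lebesgue_measure]_(y in `[0%R, 1%R]) g (y, x))%E.
Proof.
move=> mg g0; rewrite integral_mkcond fubini_tonelli2.
- rewrite [RHS]integral_mkcond; apply: eq_integral => x _.
  rewrite patchE; case: ifPn => [|] xI.
    rewrite /fubini_G [RHS]integral_mkcond; apply: eq_integral => y _.
    rewrite !patchE; congr (if _ then _ else _).
    apply/idP/idP; rewrite !inE; first by case.
    move=> yI; split => //=.
    by move: xI; rewrite inE.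
  rewrite /fubini_G integral0_eq// => y _; rewrite patchE ifF//.
  by apply/negbTE; apply: contra xI; rewrite !inE => -[].
- rewrite epatch_indic; apply: emeasurable_funM => //.
  by apply/measurable_EFinP; exact: measurable_indic measurable_square.
- by move=> z; rewrite patchE; case: ifPn.
Qed.

(** The factor [1] is the uniform marginal density, kept so that [lawE] holds by computation. The
    proof argument lets the measure structure, which relies on a nonnegative density, be attached to
    this definition. *)
Definition tilt_law (_ : small_tilt a d) (A : set (R * R)) : \bar R :=
  (\int[lebesgue2 R]_(z in A `&` S) (pdf z.1 z.2 * 1)%:E)%E.

Hypothesis small : small_tilt a d.

Let pdf0 (z : R * R) : (0 <= (pdf z.1 z.2 * 1)%:E)%E.
Proof.
by rewrite lee_fin mulr1; have := tilt_pdf_bounds _ _ x0 small z.1 z.2; lra.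
Qed.

Let mpdf : measurable_fun setT (fun z : R * R => (pdf z.1 z.2 * 1)%:E).
Proof.
apply/measurable_EFinP; apply: measurable_funM => //.
exact: measurable_tilt_pdf.
Qed.

Let tilt_law0 : tilt_law small set0 = 0%E.
Proof. by rewrite /tilt_law set0I integral_set0. Qed.

Let tilt_law_ge0 A : (0 <= tilt_law small A)%E.
Proof. by apply: integral_ge0. Qed.

Let tilt_law_sigma_additive : semi_sigma_additive (tilt_law small).
Proof.
move=> F mF tF mUF; rewrite /tilt_law; apply: cvg_toP.
  apply: ereal_nondecreasing_is_cvgn => m n mn.
  by apply: lee_sum_nneg_natr => // k _ _; apply: integral_ge0 => z _; exact: pdf0.
rewrite setI_bigcupl ge0_integral_bigcup//=.
- move=> k; exact (measurableI _ _ (mF k) measurable_square).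
- exact: measurable_funTS.
- exact: trivIset_setIr.
Qed.

HB.instance Definition _ := isMeasure.Build _ _ _ (tilt_law small)
  tilt_law0 tilt_law_ge0 tilt_law_sigma_additive.

Let tilt_law_setT : tilt_law small [set: _] = 1%E.
Proof.
rewrite /tilt_law setTI integral_square//.
transitivity (\int[@lebesgue_measure R]_(x in `[0%R, 1%R]) (cst 1 x))%E.
  apply: eq_integral => x _; under eq_integral do rewrite mulr1.
  by rewrite integral_tilt_pdf// (tilt_cdf1 _ _ _ small).
by rewrite integral_cst//= lebesgue_measure_itv/= lte01 sube0 mul1e.
Qed.

HB.instance Definition _ := @Measure_isProbability.Build _ _ R
  (tilt_law small) tilt_law_setT.

Definition tilt_dist : joint_dist R.
Proof.
refine (@JointDist R (tilt_law small) (fun=> 1) pdf _ _ _ _ _ _).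
- exact: measurable_cst.
- exact: measurable_tilt_pdf.
- by [].
- by move=> y x _ _; have := pdf0 (y, x); rewrite lee_fin mulr1.
- by move=> x _; rewrite integral_tilt_pdf// (tilt_cdf1 _ _ _ small).
- by [].
(* Transparent, since later proofs compute the projections [law] and [fYX]. *)
Defined.

Lemma integral_tilt_law (G : R * R -> \bar R) : measurable_fun setT G ->
  (forall z, 0 <= G z)%E ->
  (\int[tilt_law small]_z G z =
   \int[lebesgue2 R]_(z in S) ((pdf z.1 z.2)%:E * G z))%E.
Proof.
move=> mG G0.
rewrite (ge0_integral_density (lebesgue2 R) (tilt_law small) idfun
  (fun z => pdf z.1 z.2 * 1 * \1_S z))//.
- rewrite [RHS]integral_mkcond; apply: eq_integral => z _.
  rewrite epatch_indic/= mulr1 EFinM -!muleA; congr (_ * _)%E.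
  by rewrite muleC.
- by move=> _ A mA; rewrite setTI; exact mA.
- have mw : measurable_fun setT (fun z : R * R => pdf z.1 z.2 * 1 * \1_S z).
    apply: measurable_funM; first exact/measurable_EFinP.
    exact: measurable_indic measurable_square.
  exact mw.
- by move=> z; rewrite mulr_ge0//; have := pdf0 z; rewrite lee_fin.
- move=> A mA; transitivity (tilt_law small A) => //.
  rewrite /tilt_law integral_mkcondr; apply: eq_integral => z _.
  by rewrite epatch_indic.
Qed.

Local Notation D := tilt_dist.

Lemma condCDF_tilt y x : 0 <= y -> condCDF D y x = tilt_cdf a d x0 y x.
Proof. by move=> y0; rewrite /condCDF /Rintegral integral_tilt_pdf. Qed.

Lemma revenue_tilt y x : 0 <= y -> revenue D y x = tilt_rev a d x0 y x.
Proof. by move=> y0; rewrite /revenue condCDF_tilt. Qed.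

Lemma revenue_tilt_taylor y z x : 0 <= y -> 0 <= z <= 1 ->
  revenue D y x <= revenue D z x + tilt_slope a d x0 z x * (y - z)
                   - (1 - 3 * a) * (y - z) ^+ 2.
Proof.
by move=> y0 z01; rewrite !revenue_tilt ?(andP z01).1//; exact: tilt_taylor.
Qed.

(** At a critical price the linear Taylor term vanishes, and [1 - 3 a >= 1/2]. *)
Lemma revenue_loss_ge p q x : 0 <= p <= 1 -> tilt_slope a d x0 p x = 0 -> 0 <= q ->
  2^-1 * (q - p) ^+ 2 <= revenue D p x - revenue D q x.
Proof.
have /and4P[_ _ _ a16] := small.
move=> p01 sp q0; have := revenue_tilt_taylor _ _ x q0 p01.
by rewrite sp mul0r addr0; have := sqr_ge0 (q - p); nra.
Qed.

(** The quadratic loss makes a critical point the only maximizer, which determines the value picked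
    by [get]. *)
Lemma pD_tilt p x : 0 <= p <= 1 -> tilt_slope a d x0 p x = 0 -> pD D x = p.
Proof.
move=> p01 sp; rewrite /pD; apply: get_unique.
  split; first by rewrite in_itv.
  move=> q; rewrite in_itv/= => /andP[q0 _].
  have := revenue_loss_ge _ _ x p01 sp q0; have := sqr_ge0 (q - p); lra.
move=> q [q01 qmax].
have q0 : 0 <= q by move: q01; rewrite in_itv => /andP[].
have pI : p \in `[0, 1] by rewrite in_itv.
have := qmax _ pI; have := revenue_loss_ge _ _ x p01 sp q0.
move=> h1 h2; have : (q - p) ^+ 2 <= 0 by lra.
by rewrite exprn_even_le0//= subr_eq0 => /eqP.
Qed.

(** The slope is 1 at price 0 and minus the density, hence negative, at price 1. *)
Lemma tilt_slope_root x : exists2 p, 0 < p < 1 & tilt_slope a d x0 p x = 0.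
Proof.
have s0 : tilt_slope a d x0 0 x = 1.
  by rewrite /tilt_slope (tilt_cdf0 _ _ _ small); ring.
have s1 : tilt_slope a d x0 1 x < 0.
  rewrite /tilt_slope (tilt_cdf1 _ _ _ small).
  by have := tilt_pdf_bounds _ _ x0 small 1 x; lra.
have cs : continuous (fun p => tilt_slope a d x0 p x).
  move=> p; apply: cvgB; first apply: cvgB; first exact: cvg_cst.
    exact: continuous_tilt_cdf_y.
  by apply: cvgM; [exact: cvg_id|exact: continuous_tilt_pdf_y].
have [|p] := @IVT R (fun p => tilt_slope a d x0 p x) 0 1 0 ler01
    (continuous_subspaceT cs).
  by rewrite s0 ge_min le_max ler01 (ltW s1) orbT.
rewrite in_itv/= => /andP[p0 p1] sp; exists p => //.
rewrite !lt_neqAle p0 p1 !andbT; apply/andP; split; apply/eqP => pE.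
  by move: sp; rewrite -pE s0 => /eqP; rewrite oner_eq0.
by move: s1; rewrite -pE sp ltxx.
Qed.

Lemma pD_tilt_slope x : 0 < pD D x < 1 /\ tilt_slope a d x0 (pD D x) x = 0.
Proof.
have [p p01 sp] := tilt_slope_root x.
by rewrite (pD_tilt p)//; move: p01 => /andP[/ltW -> /ltW].
Qed.

(** For the uniform law the revenue has second derivative exactly -2; the tilt moves it by at most
    [7 a] and gives the density a Lipschitz constant at most [3 a] in the valuation. *)
Lemma tilt_regular (C0 Cs C Cl Cu : R) : 0 < C0 -> 0 < Cl <= 1 -> 1 <= Cu ->
  3 * a <= C0 -> 7 * a <= 2 - Cs -> 7 * a <= C - 2 -> 0 < Cs ->
  regular_class C0 Cs C Cl Cu D.
Proof.
have /and4P[d0 d2 a0 a16] := small.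
move=> hC0 /andP[hCl0 hCl1] hCu aC0 aCs aC hCs.
have edge01 : 0 <= edge d <= 1 by have := edge_bounds _ _ small; lra.
have ab x : 0 <= a * agnesi (xloc d x0 x) <= a.
  by have := agnesi_gt0 (xloc d x0 x); have := agnesi_le1 (xloc d x0 x); nra.
(* Twice the bound [2 a] on the density, plus the bound [3 a] on its derivative. *)
have curv y x : 0 <= y <= 1 ->
    `|2 * (pdf y x - 1) + y * (a * agnesi (xloc d x0 x) * ripple'' (yloc d y))|
    <= 7 * a.
  move=> y01; rewrite (le_trans (ler_normD _ _))// (normrM 2) (normrM y).
  rewrite (ger0_norm (andP y01).1) (ger0_norm (ler0n _ 2)) (normrM (a * _)).
  rewrite (ger0_norm (andP (ab x)).1).
  have := tilt_pdf_near1 _ _ x0 small y x; have := ripple''_le3 (yloc d y).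
  have := normr_ge0 (ripple'' (yloc d y)); have := ab x.
  move: (a * _) (ripple'' _) (_ - 1) => b e g /andP[b0 b1] e0 e3 g1.
  have : y * (b * `|e|) <= b * `|e| by rewrite ler_piMl ?mulr_ge0//; case/andP: y01.
  have : b * `|e| <= a * 3 by apply: ler_pM.
  by lra.
have dy y x : partial_y (fYX D) y x =
    a * agnesi (xloc d x0 x) * ripple'' (yloc d y).
  by rewrite /partial_y derive1E; have [_ <-] := is_derive_tilt_pdf_y _ _ x0 small y x.
have oo (z : R) : z \in `]0, 1[ -> 0 <= z <= 1.
  by rewrite in_itv/= => /andP[/ltW -> /ltW ->].
split; [split|split].
- move=> y y' x _ _ _ /=; rewrite /tilt_pdf.
  have -> : 1 + a * d * agnesi (xloc d x0 x) * ripple' (edge d) (yloc d y) -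
     (1 + a * d * agnesi (xloc d x0 x) * ripple' (edge d) (yloc d y'))
     = a * agnesi (xloc d x0 x) *
       (d * (ripple' (edge d) (yloc d y) - ripple' (edge d) (yloc d y'))).
    by ring.
  rewrite normrM (ger0_norm (andP (ab x)).1) normrM (gtr0_norm d0).
  have : d * `|ripple' (edge d) (yloc d y) - ripple' (edge d) (yloc d y')|
      <= 3 * `|y - y'|.
    rewrite -(ylocB _ _ small y y') normrM (gtr0_norm d0) mulrCA.
    rewrite ler_wpM2l ?(ltW d0)//.
    exact: ripple'_lip.
  have := ab x; have := normr_ge0 (y - y').
  have : 0 <= d * `|ripple' (edge d) (yloc d y) - ripple' (edge d) (yloc d y')|.
    by rewrite mulr_ge0// ltW.
  move: (a * agnesi _) (_ - ripple' _ _) (y - y') => b e g e0 g0 /andP[b0 b1] eg.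
  have : b * (d * `|e|) <= a * (3 * `|g|) by apply: ler_pM.
  have : 3 * a * `|g| <= C0 * `|g| by rewrite ler_wpM2r.
  by lra.
- split.
    move=> x y y' t _; rewrite !in_itv/=.
    move=> /andP[y0 y1] /andP[y0' y1'] yy' /andP[t0 t1].
    set z := t * y + (1 - t) * y'.
    have z01 : 0 <= z <= 1 by rewrite /z; apply/andP; split; nra.
    (* The expansions at the mixture [z] are averaged with weights [t] and [1 - t]: the linear terms
       cancel and the quadratic ones add up to [t (1 - t) (y - y')^2]. *)
    have := revenue_tilt_taylor _ _ x y0 z01.
    have := revenue_tilt_taylor _ _ x y0' z01.
    have q0 : 0 < (y - y') ^+ 2.
      by rewrite lt_neqAle sqr_ge0 eq_sym sqrf_eq0 subr_eq0 yy'.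
    have -> : y - z = (1 - t) * (y - y') by rewrite /z; ring.
    have -> : y' - z = - (t * (y - y')) by rewrite /z; ring.
    move: (tilt_slope _ _ _ _ _) (revenue _ _ _) (revenue _ _ _) (revenue _ _ _).
    move=> s r r1 r2 h1 h2.
    have h3 := ler_wpM2l (ltW t0) h2.
    have t1' : 0 <= 1 - t by lra.
    have h4 := ler_wpM2l t1' h1.
    have h5 : 0 < (1 - 3 * a) * (t * (1 - t)) * (y - y') ^+ 2.
      apply: mulr_gt0 q0; apply: mulr_gt0; first by lra.
      by apply: mulr_gt0; lra.
    by lra.
  apply: aeW => z /oo z1 /oo z2; split.
    by have [] := is_derive_tilt_pdf_y _ _ x0 small z.1 z.2.
  rewrite dy /=; have := curv z.1 z.2 z1; rewrite ler_norml; lra.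
- by move=> x _; have [h _] := pD_tilt_slope x; rewrite in_itv.
(* The formula for the density is smooth on the whole plane and serves as its own extension. *)
- exists setT, pdf; split.
  + exact: openT.
  + by move=> x _; exact: I.
  + by move=> y x _ _ _.
  + exact: C1_tilt_pdf.
- split.
  + apply: aeW => z /oo z1 /oo z2; split.
      by have [] := is_derive_tilt_pdf_y _ _ x0 small z.1 z.2.
    rewrite dy /=; have := curv z.1 z.2 z1; rewrite !ler_norml; lra.
  + move=> y; rewrite in_itv/= => /andP[y0 _]; split.
      have -> : (fun x => condCDF D y x : R^o)
          = (fun x => y + a * d ^+ 2 * agnesi (xloc d x0 x) *
              ripple (edge d) (yloc d y)).
        by apply/funext => x; rewrite condCDF_tilt// ltW.
      exact (lipschitz_agnesi_xloc _ _ x0 small y (a * d ^+ 2) _).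
    exact (lipschitz_agnesi_xloc _ _ x0 small 1 (a * d) _).
  + apply: aeW => z /oo z1 /oo z2.
    have cE : condCDF D z.1 = tilt_cdf a d x0 z.1.
      by apply/funext => s; rewrite condCDF_tilt//; case/andP: z1.
    split.
    * rewrite cE; by have [] := is_derive_tilt_cdf_x _ _ x0 small z.1 z.2.
    * by have [] := is_derive_tilt_pdf_x _ _ x0 small z.1 z.2.
    rewrite /partial_x cE /= !derive1E.
    have [_ ->] := is_derive_tilt_cdf_x _ _ x0 small z.1 z.2.
    have [_ ->] := is_derive_tilt_pdf_x _ _ x0 small z.1 z.2.
    have := agnesi'_le1 (xloc d x0 z.2).
    have := ripple'_le2 _ (yloc d z.1) edge01.
    have : `|d * ripple (edge d) (yloc d z.1)| <= 1.
      apply: mul_ripple_le => //; rewrite (mul_yloc _ _ small) ler_norml; lra.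
    have -> : a * d * agnesi' (xloc d x0 z.2) * ripple (edge d) (yloc d z.1) +
      z.1 * (a * agnesi' (xloc d x0 z.2) * ripple' (edge d) (yloc d z.1)) =
      a * (agnesi' (xloc d x0 z.2) * (d * ripple (edge d) (yloc d z.1) +
        z.1 * ripple' (edge d) (yloc d z.1))).
      by ring.
    move: (agnesi' _) (d * ripple _ _) (ripple' _ _) => b e f e1 f1 b1.
    have h : `|e + z.1 * f| <= 3.
      rewrite (le_trans (ler_normD _ _))// normrM (ger0_norm (andP z1).1).
      by have := normr_ge0 f; nra.
    rewrite normrM (ger0_norm a0) normrM.
    have : `|b| * `|e + z.1 * f| <= 1 * 3 by apply: ler_pM.
    by move=> /(ler_wpM2l a0); lra.
- by move=> x _; rewrite hCl1 hCu.
Qed.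

End tilt_law.

(** Bounds the n-th power of the second moment by [1 / (1 - n t)] when [n t < 1]. The induction
    rests on [(1 + t)(1 - (n + 1) t) <= 1 - n t]. *)
Lemma expr1D_mul_le1 {R : realFieldType} (t : R) n : 0 <= t ->
  (1 + t) ^+ n * (1 - n%:R * t) <= 1.
Proof.
move=> t0; elim: n => [|n IH]; first by rewrite expr0; lra.
rewrite (le_trans _ IH)// exprSr -mulrA ler_wpM2l ?exprn_ge0//; first by lra.
have := ler0n R n; rewrite -natr1; nra.
Qed.

(** * Likelihood ratio and chi-square distance of the two laws *)

Section tilt_pair.
Context {R : realType}.
Variables (a d x0 : R).
Hypothesis small : small_tilt a d.
Local Notation pdf := (tilt_pdf a d x0).

Lemma small_tilt0 : small_tilt 0 d.
Proof. by move: small => /and4P[d0 d2 _ _]; rewrite /small_tilt d0 d2; lra. Qed.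

Lemma tilt_pdf0 y x : tilt_pdf 0 d x0 y x = 1.
Proof. by rewrite /tilt_pdf !mul0r addr0. Qed.

Lemma integral_tilt_law_ratio (G : R * R -> \bar R) : measurable_fun setT G ->
  (forall z, 0 <= G z)%E ->
  (\int[tilt_law a d x0 small]_z G z =
   \int[tilt_law 0 d x0 small_tilt0]_z ((pdf z.1 z.2)%:E * G z))%E.
Proof.
move=> mG G0; rewrite !integral_tilt_law//.
- by apply: eq_integral => z _; rewrite tilt_pdf0 mul1e.
- apply: emeasurable_funM => //; apply/measurable_EFinP.
  exact: measurable_tilt_pdf.
- move=> z; rewrite mule_ge0// lee_fin.
  by have := tilt_pdf_bounds _ _ x0 small z.1 z.2; lra.
Qed.

(** Integrating the bound [16 a^2 d^3 agnesi] over the covariate gives one more [d] and the factor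
    4. *)
Lemma integral_tilt_ratio_sqr :
  (\int[tilt_law 0 d x0 small_tilt0]_z (pdf z.1 z.2 ^+ 2)%:E
    <= (1 + 64 * a ^+ 2 * d ^+ 4)%:E)%E.
Proof.
have /and4P[d0 d2 a0 a16] := small.
have mp : measurable_fun setT (fun z : R * R => (pdf z.1 z.2 ^+ 2)%:E).
  by apply/measurable_EFinP; apply: measurable_funX; exact: measurable_tilt_pdf.
have p0 (z : R * R) : (0 <= (pdf z.1 z.2 ^+ 2)%:E)%E by rewrite lee_fin sqr_ge0.
rewrite integral_tilt_law//.
under eq_integral do rewrite tilt_pdf0 mul1e.
rewrite integral_square//=.
have -> : 1 + 64 * a ^+ 2 * d ^+ 4 = 1 + (16 * a ^+ 2 * d ^+ 3) * d * 4 by ring.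
apply: le_trans (integral_one_agnesi _ _ x0 small _ _); last first.
  apply: mulr_ge0; last exact: exprn_ge0 (ltW d0).
  by apply: mulr_ge0 => //; exact: sqr_ge0.
apply: ge0_le_integral => //=.
- by move=> x _; apply: integral_ge0 => y _; rewrite lee_fin sqr_ge0.
(* Measurability of the inner integral comes from Tonelli over the whole line, so the domain becomes
   an indicator factor. *)
- apply: measurable_funTS; under eq_fun do rewrite integral_mkcond epatch_indic.
  pose g (z : R * R) : \bar R :=
    ((pdf z.1 z.2 ^+ 2)%:E * (\1_(`[0, 1]%classic) z.1)%:E)%E.
  have mg : measurable_fun setT g.
    apply: emeasurable_funM => //; apply/measurable_EFinP.
    by apply: measurableT_comp => //; exact: measurable_indic.
  have g0 z : (0 <= g z)%E by rewrite mule_ge0.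
  exact: (measurable_fun_fubini_tonelli_G (m1 := @lebesgue_measure R) g mg g0).
- apply/measurable_EFinP/measurable_funTS; apply: continuous_measurable_fun.
  move=> x; apply: cvgD; first exact: cvg_cst.
  apply: cvgM; first exact: cvg_cst.
  by apply: continuous_comp; [exact: continuous_affine|exact: continuous_agnesi].
- by move=> x _; exact: integral_tilt_pdf_sqr.
Qed.

End tilt_pair.

(** * The revenue gap as an expected loss *)

Section tilt_gap.
Context {R : realType}.
Variables (a d x0 : R).
Hypothesis small : small_tilt a d.
Local Notation D := (tilt_dist a d x0 small).

(** The perturbation changes [1 - F(y)], which is [1 - y] for the uniform law, by at most
    [a (1 - y)]. *)
Lemma revenue_tilt_ge0 y x : 0 <= y <= 1 -> 0 <= revenue D y x.
Proof.
have /and4P[d0 d2 a0 a16] := small.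
move=> /andP[y0 y1]; rewrite revenue_tilt// mulr_ge0//.
have := ripple_yloc_lip _ _ small 1 y.
have -> : 1 - tilt_cdf a d x0 y x = (1 - y) + a * agnesi (xloc d x0 x) *
    (d ^+ 2 * (ripple (edge d) (yloc d 1) - ripple (edge d) (yloc d y))).
  by rewrite -{1}(tilt_cdf1 _ _ x0 small x) /tilt_cdf; ring.
rewrite -{1}(ger0_norm (sqr_ge0 d)) -normrM (ger0_norm (x := 1 - y)); last by lra.
move: (d ^+ 2 * _) => e; rewrite ler_norml => /andP[e1 e2].
have b0 := agnesi_gt0 (xloc d x0 x); have b1 := agnesi_le1 (xloc d x0 x).
have ab : 0 <= a * agnesi (xloc d x0 x) <= 1 by apply/andP; split; nra.
have : a * agnesi (xloc d x0 x) * - (1 - y) <= a * agnesi (xloc d x0 x) * e.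
  by rewrite ler_wpM2l//; case/andP: ab.
by nra.
Qed.

Lemma measurable_revenue_tilt n (p : n.-tuple (R * R) -> R -> R) x :
  pricing_strategy p -> x \in `[0, 1] ->
  measurable_fun setT (fun s => revenue D (p s x) x).
Proof.
move=> [_ mp p01] x01.
have -> : (fun s => revenue D (p s x) x) = (fun y => tilt_rev a d x0 y x) \o (p ^~ x).
  apply/funext => s; rewrite /= revenue_tilt//.
  by have := p01 s x x01; rewrite in_itv => /andP[].
apply: measurableT_comp; last exact: mp.
apply: continuous_measurable_fun => y; apply: cvgM; first exact: cvg_id.
by apply: cvgB; [exact: cvg_cst|exact: continuous_tilt_cdf_y].
Qed.

(** Expected revenue and expected loss are nonnegative with finite sum, so the extended-real
    subtraction is legitimate. *)
Lemma revenue_gap_tilt n (p : n.-tuple (R * R) -> R -> R) x :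
  pricing_strategy p -> x \in `[0, 1] ->
  (revenue_gap D p x = \int[iid (law D) n]_s
     (revenue D (pD D x) x - revenue D (p s x) x)%:E)%E.
Proof.
move=> ps x01; have [/andP[/ltW q0 /ltW q1] sq] := pD_tilt_slope a d x0 small x.
set P := iid (law D) n; set r := revenue D (pD D x) x.
have p01 s : 0 <= p s x <= 1.
  by have [_ _ h] := ps; have := h s x x01; rewrite in_itv.
have mr := measurable_revenue_tilt n p x ps x01.
have L0 s : 0 <= r - revenue D (p s x) x.
  have /andP[p0 _] := p01 s; have q01 : 0 <= pD D x <= 1 by rewrite q0.
  have := revenue_loss_ge _ _ _ small _ _ _ q01 sq p0.
  by apply: le_trans; rewrite mulr_ge0// sqr_ge0.
have f0 s : 0 <= revenue D (p s x) x by exact: revenue_tilt_ge0.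
have mL : measurable_fun setT (fun s => r - revenue D (p s x) x).
  exact: measurable_funB.
have E : (\int[P]_s (revenue D (p s x) x)%:E
          + \int[P]_s (r - revenue D (p s x) x)%:E = r%:E)%E.
  rewrite -ge0_integralD//; last 4 first.
  - by move=> s _; rewrite lee_fin.
  - exact/measurable_EFinP.
  - by move=> s _; rewrite lee_fin.
  - exact/measurable_EFinP.
  under eq_integral do rewrite -EFinD addrC subrK.
  by rewrite integral_cst// -[RHS]mule1; congr (_ * _)%E; exact: (probability_setT P).
rewrite /revenue_gap unlock -/P -/r -E addeC addeK//.
rewrite ge0_fin_numE; last by apply: integral_ge0 => s _; rewrite lee_fin.
apply: (@le_lt_trans _ _ r%:E); last exact: ltry.
by rewrite -E leeDl//; apply: integral_ge0 => s _; rewrite lee_fin.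
Qed.

End tilt_gap.

(** * The two-point lower bound and the choice of constants *)

Lemma minimax_gap_ge {R : realType} (a d x0 : R) (small : small_tilt a d) n
    (F : set (joint_dist R)) :
  0 < a -> n%:R * d ^+ 4 = 1 -> 0 < x0 < 1 ->
  F (tilt_dist 0 d x0 (small_tilt0 a d small)) -> F (tilt_dist a d x0 small) ->
  ((a ^+ 2 / 3456 * d ^+ 2)%:E <= minimax_gap n x0 F)%E.
Proof.
move=> a0 nd /andP[/ltW x00 /ltW x01] F0 F1.
have /and4P[d0 d2 _ a16] := small.
(* A quarter of the squared price shift [(a d / 12)^2]; the final constant 3456 is [6 * 576]. *)
pose k : R := a ^+ 2 * d ^+ 2 / 576.
have k0 : 0 < k by rewrite /k divr_gt0 ?ltr0n ?mulr_gt0 ?exprn_gt0.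
have x0I : x0 \in `[0, 1] by rewrite in_itv /= x00 x01.
set small0 := small_tilt0 a d small.
set D0 := tilt_dist 0 d x0 small0; set D1 := tilt_dist a d x0 small.
apply: le_ereal_inf_tmp => _ [p sp <-]; set M := ereal_sup _.
have gM0 : (revenue_gap D0 p x0 <= M)%E by apply: ereal_sup_ubound; exists D0.
have gM1 : (revenue_gap D1 p x0 <= M)%E by apply: ereal_sup_ubound; exists D1.
rewrite !revenue_gap_tilt// in gM0 gM1.
have h01 : 0 <= (2^-1 : R) <= 1 by rewrite invr_ge0 ler0n invf_le1 ?ler1n ?ltr0n.
have s0 : tilt_slope 0 d x0 2^-1 x0 = 0.
  by rewrite tilt_slope_half !mul0r oppr0.
have [/andP[/ltW q0 /ltW q1] sq] := pD_tilt_slope a d x0 small x0.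
have q01 : 0 <= pD D1 x0 <= 1 by rewrite q0.
have shift := tilt_price_shift _ _ _ small _ q01 sq.
have pD0 : pD D0 x0 = 2^-1 by exact: pD_tilt.
rewrite pD0 in gM0.
set q := pD D1 x0 in q0 q1 q01 sq gM1 shift.
pose L0 s := revenue D0 2^-1 x0 - revenue D0 (p s x0) x0.
pose L1 s := revenue D1 q x0 - revenue D1 (p s x0) x0.
have p0 s : 0 <= p s x0.
  by have [_ _ h] := sp; have := h s x0 x0I; rewrite in_itv => /andP[].
have L0_ge s : 2^-1 * (p s x0 - 2^-1) ^+ 2 <= L0 s by exact: revenue_loss_ge.
have L1_ge s : 2^-1 * (p s x0 - q) ^+ 2 <= L1 s by exact: revenue_loss_ge.
have mL0 : measurable_fun setT L0.
  by apply: measurable_funB => //; exact: measurable_revenue_tilt.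
have mL1 : measurable_fun setT L1.
  by apply: measurable_funB => //; exact: measurable_revenue_tilt.
(* Half the sum of the squared distances to two points is at least a quarter of their squared
   separation, so no price does well under both laws. *)
have kL s : k <= L0 s + L1 s.
  have : (a * d / 12) ^+ 2 <= (q - 2^-1) ^+ 2.
    rewrite -(real_normK (num_real (q - _))) ler_sqr ?nnegrE//.
    by rewrite !mulr_ge0// ltW.
  have := L0_ge s; have := L1_ge s.
  have := sqr_ge0 ((p s x0 - 2^-1) + (p s x0 - q)).
  rewrite /k; nra.
have L0_0 s : 0 <= L0 s.
  by apply: le_trans (L0_ge s); rewrite mulr_ge0// sqr_ge0.
have L1_0 s : 0 <= L1 s.
  by apply: le_trans (L1_ge s); rewrite mulr_ge0// sqr_ge0.
have {}gM0 : (\int[iid (law D0) n]_s (L0 s)%:E <= M)%E by exact: gM0.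
have {}gM1 : (\int[iid (law D1) n]_s (L1 s)%:E <= M)%E by exact: gM1.
move: L0 L1 mL0 mL1 L0_0 L1_0 kL gM0 gM1 {L0_ge L1_ge} => L0 L1.
move=> mL0 mL1 L0_0 L1_0 kL gM0 gM1.
have mpdf := measurable_tilt_pdf a d x0.
(* The two-point inequality with weight 1, for the losses normalized by [k]. *)
have LC : (1%:E <= \int[iid (law D0) n]_s (k^-1 * L0 s)%:E
    + 1%:E * \int[iid (law D1) n]_s (k^-1 * L1 s)%:E
    + (1 ^+ 2 * (1 + 64 * a ^+ 2 * d ^+ 4) ^+ n / 4)%:E)%E.
  apply: (@le_cam_two_points _ _ _ (law D0) (law D1) _ _ mpdf _
    (integral_tilt_law_ratio a d x0 small) (integral_tilt_ratio_sqr a d x0 small)).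
  - by move=> z; have := tilt_pdf_bounds _ _ x0 small z.1 z.2; lra.
  - exact: ler01.
  - by apply: measurable_funM; [exact: measurable_cst|exact: mL0].
  - by apply: measurable_funM; [exact: measurable_cst|exact: mL1].
  - by move=> s; rewrite mulr_ge0// invr_ge0 ltW.
  - by move=> s; rewrite mulr_ge0// invr_ge0 ltW.
  - by move=> s; rewrite -mulrDr ler_pdivlMl// mulr1.
(* As [n d^4 = 1] and [a <= 1/16], the exponent budget [64 a^2] is at most 1/4, so the power is at
   most 4/3. *)
have Kn : (1 + 64 * a ^+ 2 * d ^+ 4) ^+ n / 4 <= 3^-1.
  have t0 : 0 <= 64 * a ^+ 2 * d ^+ 4.
    apply: mulr_ge0; last exact: exprn_ge0 (ltW d0).
    by apply: mulr_ge0 => //; exact: sqr_ge0.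
  have := expr1D_mul_le1 _ n t0.
  have -> : n%:R * (64 * a ^+ 2 * d ^+ 4) = 64 * a ^+ 2 * (n%:R * d ^+ 4) by ring.
  rewrite nd mulr1; have : 64 * a ^+ 2 <= 4^-1 by nra.
  have : 0 <= (1 + 64 * a ^+ 2 * d ^+ 4) ^+ n by rewrite exprn_ge0//; lra.
  by set X := (1 + _) ^+ n; set Y := 64 * _ => X0 Y0 XY; nra.
(* If [M] were below [k / 6], the right side of [LC] would be at most [1/6 + 1/6 + 1/3 < 1]. *)
rewrite leNgt; apply/negP => Mk.
have bound (P : probability (n.-tuple (R * R)%type) R)
    (L : n.-tuple (R * R)%type -> R) :
    measurable_fun setT L -> (forall s, 0 <= L s) ->
    (\int[P]_s (L s)%:E <= M -> \int[P]_s (k^-1 * L s)%:E <= (6^-1)%:E)%E.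
  move=> mL Lge0 LM; under eq_integral do rewrite EFinM.
  rewrite ge0_integralZl//; last 3 first.
  - exact/measurable_EFinP.
  - by move=> s _; rewrite lee_fin.
  - by rewrite lee_fin invr_ge0 ltW.
  rewrite lee_pdivrMl// -EFinM (le_trans LM)// (le_trans (ltW Mk))// lee_fin.
  by rewrite /k; lra.
have b0 := bound _ _ mL0 L0_0 gM0; have b1 := bound _ _ mL1 L1_0 gM1.
move: LC; rewrite leNgt => /negP; apply; rewrite mul1e expr1n mul1r.
apply: (@le_lt_trans _ _ ((6^-1)%:E + (6^-1)%:E + (3^-1)%:E)%E).
  by apply: leeD; [exact: leeD|rewrite lee_fin].
by rewrite -!EFinD lte_fin; lra.
Qed.

(** The uniform law has curvature 2 and marginal density 1; the strict bounds [Cs < 2 < Cbar] leave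
    room for a tilt of it inside the class. *)
Theorem theorem3 (R : realType) (C0 Cs Cbar Clow Cbar' : R)
    (hC0 : 0 < C0) (hCs : 0 < Cs < 2) (hCbar : 2 < Cbar)
    (hClow : 0 < Clow <= 1) (hCbar' : 1 <= Cbar') :
  exists c c' c'' : R,
    [/\ 0 < c, 0 < c', 0 < c'' &
      forall (n : nat) (x0 : R),
        0 < x0 < 1 ->
        c' <= x0 * n%:R `^ (4^-1) ->
        c'' <= (1 - x0) * n%:R `^ (4^-1) ->
        ((c * n%:R `^ (- 2^-1))%:E
           <= minimax_gap n x0 (regular_class C0 Cs Cbar Clow Cbar'))%E].
Proof.
have /andP[Cs0 Cs2] := hCs.
(* The amplitude depends on the class constants only: 1/16 for [small_tilt], the other bounds for
   [tilt_regular]. *)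
have [a [a0 a16 aC0 aCs aCbar]] : exists a : R,
    [/\ 0 < a, a <= 16^-1, a <= C0 / 3, a <= (2 - Cs) / 7 & a <= (Cbar - 2) / 7].
  exists (Num.min (Num.min (16^-1) (C0 / 3))
                  (Num.min ((2 - Cs) / 7) ((Cbar - 2) / 7))).
  split; rewrite ?lt_min ?ge_min ?lexx ?orbT//.
  by apply/andP; split; apply/andP; split; lra.
exists (a ^+ 2 / 3456), 1, 1.
split; [by rewrite divr_gt0 ?exprn_gt0 ?ltr0n|exact: ltr01|exact: ltr01|].
move=> n x0 x01 h1 h2.
set t := n%:R `^ (4^-1) in h1 h2.
(* The sum of the two boundary conditions. It gives [d = 1 / t <= 1/2] and excludes [n = 0], where
   [t] would be 0. *)
have t2 : 2 <= t by lra.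
have t4 : t ^+ 4 = n%:R.
  by rewrite /t -powR_mulrn ?powR_ge0// -powRrM mulVf// powRr1.
have d2E : n%:R `^ (- 2^-1) = t^-1 ^+ 2 :> R.
  rewrite powRN exprVn; congr (_^-1).
  rewrite /t -powR_mulrn ?powR_ge0// -powRrM; congr (_ `^ _); lra.
have small : small_tilt a t^-1.
  rewrite /small_tilt invr_gt0 (ltW a0) a16 lef_pV2 ?posrE//; lra.
have nd : n%:R * t^-1 ^+ 4 = 1.
  by rewrite -t4 -exprMn mulfV ?expr1n// gt_eqF//; lra.
rewrite d2E; apply: (minimax_gap_ge a _ _ small) => //; apply: tilt_regular => //; lra.
Qed.
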